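(* Let $(N^{2n},P,h,\widetilde h)$ be a $2n$-dimensional paraholomorphic paracomplex Riemannian manifold. Then the product manifold $M^{2n+1}=\mathbb R\times N^{2n}$, equipped with the almost paracontact paracomplex Riemannian structure $(\phi,\xi,\eta,g)$ defined by $$\eta=dt,\quad \xi=\tfrac{d}{dt},\quad \phi|_H=P,\quad \eta\circ\phi=0,\quad \phi\xi=0,\quad g=dt^2+\cosh(2t)\,h+\sinh(2t)\,\widetilde h,$$ where $t$ is the coordinate on $\mathbb R$ and $H=\ker\eta=TN^{2n}$, is a para-Sasaki-like Riemannian manifold. If the Riemannian manifold $(N^{2n},h)$ is complete, then the para-Sasaki-like Riemannian manifold $(M^{2n+1},g)=(\mathbb R\times N^{2n},g)$ is complete.
   Context: A $2n$-dimensional paraholomorphic paracomplex Riemannian manifold $(N,P,h,\widetilde h)$ is a smooth manifold with a $(1,1)$-tensor $P$, $P^2=\mathrm{id}$, $P\neq\pm\mathrm{id}$, $\mathrm{tr}\,P=0$, and a Riemannian metric $h$ such that $h(PX,PY)=h(X,Y)$ and $P$ is parallel with respect to the Levi-Civita connection of $h$; $\widetilde h(X,Y)=h(X,PY)$ is the associated neutral metric. An almost paracontact paracomplex Riemannian manifold $(M,\phi,\xi,\eta,g)$ is a smooth manifold of dimension $2n+1$ with a $(1,1)$-tensor field $\phi$, a vector field $\xi$, a 1-form $\eta$ satisfying $\phi^2=\mathrm{id}-\eta\otimes\xi$, $\eta(\xi)=1$, such that on $H=\ker\eta$ the eigenvalues $+1$ and $-1$ of $\phi|_H$ both have multiplicity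 $n$, and a Riemannian metric $g$ with $g(x,\xi)=\eta(x)$ and $g(\phi x,\phi y)=g(x,y)-\eta(x)\eta(y)$. With $\nabla$ the Levi-Civita connection of $g$ and $F(x,y,z)=g((\nabla_x\phi)y,z)$, it is called para-Sasaki-like if for all horizontal $X,Y,Z\in H$: $F(X,Y,Z)=F(\xi,Y,Z)=F(\xi,\xi,Z)=0$ and $F(X,Y,\xi)=-g(X,Y)$. *)

(* Defs.v *)
From mathcomp Require Export all_boot all_order all_algebra.
From mathcomp Require Export all_classical all_reals all_analysis.

Set Implicit Arguments.
Unset Strict Implicit.
Unset Printing Implicit Defensive.

Import Order.TTheory GRing.Theory Num.Theory.
Import numFieldNormedType.Exports.

Local Open Scope classical_set_scope.
Local Open Scope ring_scope.

(** ** Smooth functions on open subsets of R^m *)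

Fixpoint Ck (R : realType) (m k : nat) (U : set 'rV[R]_m) (f : 'rV[R]_m -> R)
    : Prop :=
  match k with
  | 0 => forall x, U x -> {for x, continuous f}
  | k'.+1 => (forall x, U x -> differentiable f x) /\
             forall a : 'I_m, Ck k' U (fun x => 'D_(delta_mx 0 a) f x)
  end.

Definition smooth_on (R : realType) (m : nat) (U : set 'rV[R]_m)
    (f : 'rV[R]_m -> R) : Prop :=
  forall k, Ck k U f.

(** ** Smooth manifolds *)

(* [coord] is only meaningful on [dom], and [param], its inverse, only on
   [coord @` dom]. *)
Record chart (R : realType) (M : topologicalType) (m : nat) := Chart {
  dom : set M;
  coord : M -> 'rV[R]_m;
  param : 'rV[R]_m -> M }.

Definition chart_img (R : realType) (M : topologicalType) (m : nat)
  (c : chart R M m) : set 'rV[R]_m := coord c @` dom c.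

Definition is_chart (R : realType) (M : topologicalType) (m : nat)
    (c : chart R M m) : Prop :=
  [/\ open (dom c), open (chart_img c),
      forall p, dom c p -> param c (coord c p) = p,
      forall p, dom c p -> {for p, continuous (coord c)} &
      forall x, chart_img c x -> {for x, continuous (param c)}].

(* [chart_at p] is a chosen chart around [p]. *)
Record atlas (R : realType) (M : topologicalType) (m : nat) := Atlas {
  index : Type;
  chart_of :> index -> chart R M m;
  chart_at : M -> index }.

Definition smooth_manifold (R : realType) (M : topologicalType) (m : nat)
    (A : atlas R M m) : Prop :=
  [/\ hausdorff_space M, @second_countable M,
      forall i, is_chart (A i),
      forall p, dom (A (chart_at A p)) p &
      forall (i j : index A) (b : 'I_m),
        smooth_on (coord (A i) @` (dom (A i) `&` dom (A j)))
                  (fun x => coord (A j) (param (A i) x) 0 b)].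

(** ** Tensor fields and connections *)

(* A tensor field is the family of its component matrices in the charts of the
   atlas; only the values of the i-th component on [dom (A i)] matter.
   A tangent vector is the row of its components, so an endomorphism T sends x
   to [x *m T], a 1-form is a column and maps x to [x *m eta], and a bilinear
   form maps (x, y) to [x *m G *m y^T]. *)
Definition field (R : realType) (M : topologicalType) (m : nat)
  (A : atlas R M m) (r s : nat) : Type := index A -> M -> 'M[R]_(r, s).

Definition pd (R : realType) (M : topologicalType) (m : nat) (A : atlas R M m)
    (i : index A) (a : 'I_m) (r s : nat) (T : M -> 'M[R]_(r, s)) (p : M)
    : 'M[R]_(r, s) :=
  \matrix_(b, c) 'D_(delta_mx 0 a) (fun x => T (param (A i) x) b c)
                                   (coord (A i) p).

Definition jac (R : realType) (M : topologicalType) (m : nat) (A : atlas R M m)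
    (i j : index A) (p : M) : 'M[R]_m :=
  jacobian (coord (A j) \o param (A i)) (coord (A i) p).

Definition smooth_field (R : realType) (M : topologicalType) (m : nat)
    (A : atlas R M m) (r s : nat) (T : field A r s) : Prop :=
  forall i b c, smooth_on (chart_img (A i)) (fun x => T i (param (A i) x) b c).

Definition overlap (R : realType) (M : topologicalType) (m : nat)
    (A : atlas R M m) (i j : index A) : set M := dom (A i) `&` dom (A j).

Definition vector_field (R : realType) (M : topologicalType) (m : nat)
    (A : atlas R M m) (X : field A 1 m) : Prop :=
  smooth_field X /\
  forall i j p, overlap i j p -> X j p = X i p *m jac i j p.

Definition one_form (R : realType) (M : topologicalType) (m : nat)
    (A : atlas R M m) (eta : field A m 1) : Prop :=
  smooth_field eta /\
  forall i j p, overlap i j p -> eta i p = jac i j p *m eta j p.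

Definition endo_field (R : realType) (M : topologicalType) (m : nat)
    (A : atlas R M m) (T : field A m m) : Prop :=
  smooth_field T /\
  forall i j p, overlap i j p -> T i p *m jac i j p = jac i j p *m T j p.

Definition bilinear_field (R : realType) (M : topologicalType) (m : nat)
    (A : atlas R M m) (G : field A m m) : Prop :=
  smooth_field G /\
  forall i j p, overlap i j p ->
    G i p = jac i j p *m G j p *m (jac i j p)^T.

Definition bil (R : realType) (m : nat) (G : 'M[R]_m) (x y : 'rV[R]_m) : R :=
  (x *m G *m y^T) 0 0.

Definition riemannian (R : realType) (M : topologicalType) (m : nat)
    (A : atlas R M m) (g : field A m m) : Prop :=
  [/\ bilinear_field g,
      forall i p, dom (A i) p -> (g i p)^T = g i p &
      forall i p x, dom (A i) p -> x != 0 -> 0 < bil (g i p) x x].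

(* [D i p a b c] is the Christoffel symbol Gamma^c_(a b) at p in the i-th
   chart: the covariant derivative of d_b along d_a is the sum over c of
   [D i p a b c] d_c. *)
Definition christoffel (R : realType) (M : topologicalType) (m : nat)
  (A : atlas R M m) : Type := index A -> M -> 'I_m -> 'M[R]_m.

Definition connection (R : realType) (M : topologicalType) (m : nat)
    (A : atlas R M m) (D : christoffel A) : Prop :=
  (forall a, @smooth_field _ _ _ A m m (fun i p => D i p a)) /\
  forall i j p a, overlap i j p ->
    D i p a *m jac i j p =
    pd i a (jac i j) p +
    \sum_(d < m) jac i j p a d *: (jac i j p *m D j p d).

(* Torsion-freeness, and g(nabla_a d_b, d_c) + g(d_b, nabla_a d_c) = d_a g_bc. *)
Definition levi_civita (R : realType) (M : topologicalType) (m : nat)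
    (A : atlas R M m) (g : field A m m) (D : christoffel A) : Prop :=
  [/\ connection D,
      forall i p a b c, dom (A i) p -> D i p a b c = D i p b a c &
      forall i p a, dom (A i) p ->
        pd i a (g i) p = D i p a *m g i p + g i p *m (D i p a)^T].

(* The endomorphism nabla_x T at p in the i-th chart: y is sent to
   nabla_x (T y) - T (nabla_x y). *)
Definition nabla_endo (R : realType) (M : topologicalType) (m : nat)
    (A : atlas R M m) (D : christoffel A) (T : field A m m)
    (i : index A) (p : M) (x : 'rV[R]_m) : 'M[R]_m :=
  \sum_(a < m)
    x 0 a *: (pd i a (T i) p + T i p *m D i p a - D i p a *m T i p).

(** ** Completeness *)

Definition C1_curve (R : realType) (M : topologicalType) (m : nat)
    (A : atlas R M m) (gamma : R -> M) : Prop :=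
  continuous gamma /\
  forall s i, dom (A i) (gamma s) ->
    derivable (coord (A i) \o gamma) s 1 /\
    {for s, continuous (derive1 (coord (A i) \o gamma))}.

(* The chart at [gamma s] is used only to compute: by the transformation law of
   g the speed does not depend on it. *)
Definition speed (R : realType) (M : topologicalType) (m : nat)
    (A : atlas R M m) (g : field A m m) (gamma : R -> M) (s : R) : R :=
  let i := chart_at A (gamma s) in
  let v := derive1 (coord (A i) \o gamma) s in
  Num.sqrt (bil (g i (gamma s)) v v).

Definition curve_length (R : realType) (M : topologicalType) (m : nat)
    (A : atlas R M m) (g : field A m m) (gamma : R -> M) (a b : R) : \bar R :=
  (\int[lebesgue_measure]_(s in `[a, b]) (speed g gamma s)%:E)%E.

(* [path_length g p q L]: some piecewise C^1 curve from p to q has length L.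
   A piece is the restriction to [a, b] of a C^1 curve defined on R; every
   C^1 curve on [a, b] extends to such a curve. *)
Inductive path_length (R : realType) (M : topologicalType) (m : nat)
    (A : atlas R M m) (g : field A m m) : M -> M -> \bar R -> Prop :=
  | path_nil p : path_length g p p 0%E
  | path_cons gamma a b q L :
      a <= b -> C1_curve A gamma -> path_length g (gamma b) q L ->
      path_length g (gamma a) q (curve_length g gamma a b + L)%E.

(* +oo when p and q lie in different connected components. *)
Definition riem_dist (R : realType) (M : topologicalType) (m : nat)
    (A : atlas R M m) (g : field A m m) (p q : M) : \bar R :=
  ereal_inf [set L | path_length g p q L].

Definition riem_cauchy (R : realType) (M : topologicalType) (m : nat)
    (A : atlas R M m) (g : field A m m) (u : nat -> M) : Prop :=
  forall e : R, 0 < e -> exists K : nat, forall k l : nat,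
    (K <= k)%N -> (K <= l)%N -> (riem_dist g (u k) (u l) < e%:E)%E.

Definition riem_cvg (R : realType) (M : topologicalType) (m : nat)
    (A : atlas R M m) (g : field A m m) (u : nat -> M) (p : M) : Prop :=
  forall e : R, 0 < e -> exists K : nat, forall k : nat,
    (K <= k)%N -> (riem_dist g (u k) p < e%:E)%E.

Definition riem_complete (R : realType) (M : topologicalType) (m : nat)
    (A : atlas R M m) (g : field A m m) : Prop :=
  forall u : nat -> M, riem_cauchy g u -> exists p, riem_cvg g u p.

(** ** Paraholomorphic and para-Sasaki-like manifolds *)

Record paraholomorphic (R : realType) (N : topologicalType) (n : nat)
    (A : atlas R N n.*2) (P h : field A n.*2 n.*2) : Prop := Paraholomorphic {
  ph_manifold : smooth_manifold A;
  ph_endo : endo_field P;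
  ph_sqr : forall i p, dom (A i) p -> P i p *m P i p = 1%:M;
  ph_neq_id : ~ (forall i p, dom (A i) p -> P i p = 1%:M);
  ph_neq_opp : ~ (forall i p, dom (A i) p -> P i p = - 1%:M);
  ph_tr : forall i p, dom (A i) p -> \tr (P i p) = 0;
  ph_metric : riemannian h;
  ph_compat : forall i p x y, dom (A i) p ->
    bil (h i p) (x *m P i p) (y *m P i p) = bil (h i p) x y;
  ph_parallel : exists2 D, levi_civita h D &
    forall i p x, dom (A i) p -> nabla_endo D P i p x = 0 }.

(* (x, y) |-> h(x, P y) *)
Definition assoc_metric (R : realType) (N : topologicalType) (m : nat)
    (A : atlas R N m) (P h : field A m m) : field A m m :=
  fun i p => h i p *m (P i p)^T.

(* [kermx (eta i p)] is the horizontal space H = ker eta. *)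
Record almost_paracontact (R : realType) (M : topologicalType) (n : nat)
    (A : atlas R M (1 + n.*2)) (phi : field A (1 + n.*2) (1 + n.*2))
    (xi : field A 1 (1 + n.*2)) (eta : field A (1 + n.*2) 1)
    (g : field A (1 + n.*2) (1 + n.*2)) : Prop := AlmostParacontact {
  apc_manifold : smooth_manifold A;
  apc_phi : endo_field phi;
  apc_xi : vector_field xi;
  apc_eta : one_form eta;
  apc_sqr : forall i p, dom (A i) p ->
    phi i p *m phi i p = 1%:M - eta i p *m xi i p;
  apc_eta_xi : forall i p, dom (A i) p -> xi i p *m eta i p = 1%:M;
  apc_mult1 : forall i p, dom (A i) p ->
    \rank (eigenspace (phi i p) 1 :&: kermx (eta i p))%MS = n;
  apc_multN1 : forall i p, dom (A i) p ->
    \rank (eigenspace (phi i p) (-1) :&: kermx (eta i p))%MS = n;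
  apc_metric : riemannian g;
  apc_g_xi : forall i p x, dom (A i) p ->
    bil (g i p) x (xi i p) = (x *m eta i p) 0 0;
  apc_compat : forall i p x y, dom (A i) p ->
    bil (g i p) (x *m phi i p) (y *m phi i p) =
    bil (g i p) x y - (x *m eta i p) 0 0 * (y *m eta i p) 0 0 }.

(* F(x, y, z) = g((nabla_x phi) y, z) *)
Definition Ftensor (R : realType) (M : topologicalType) (m : nat)
    (A : atlas R M m) (D : christoffel A) (phi g : field A m m)
    (i : index A) (p : M) (x y z : 'rV[R]_m) : R :=
  bil (g i p) (y *m nabla_endo D phi i p x) z.

Definition para_sasaki_like (R : realType) (M : topologicalType) (n : nat)
    (A : atlas R M (1 + n.*2)) (phi : field A (1 + n.*2) (1 + n.*2))
    (xi : field A 1 (1 + n.*2)) (eta : field A (1 + n.*2) 1)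
    (g : field A (1 + n.*2) (1 + n.*2)) : Prop :=
  almost_paracontact phi xi eta g /\
  exists2 D, levi_civita g D &
    forall i p x y z, dom (A i) p ->
      x *m eta i p = 0 -> y *m eta i p = 0 -> z *m eta i p = 0 ->
      [/\ Ftensor D phi g i p x y z = 0,
          Ftensor D phi g i p (xi i p) y z = 0,
          Ftensor D phi g i p (xi i p) (xi i p) z = 0 &
          Ftensor D phi g i p x y (xi i p) = - bil (g i p) x y].

(** ** The product R x N *)

Definition prod_chart (R : realType) (M N : topologicalType) (m k : nat)
    (c : chart R M m) (d : chart R N k) : chart R (M * N)%type (m + k) :=
  Chart (dom c `*` dom d)
        (fun p => row_mx (coord c p.1) (coord d p.2))
        (fun x => (param c (lsubmx x), param d (rsubmx x))).

Definition prod_atlas (R : realType) (M N : topologicalType) (m k : nat)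
    (A : atlas R M m) (B : atlas R N k) : atlas R (M * N)%type (m + k) :=
  @Atlas R (M * N)%type (m + k) (index A * index B)%type
         (fun ij => prod_chart (A ij.1) (B ij.2))
         (fun p => (chart_at A p.1, chart_at B p.2)).

Definition line_atlas (R : realType) : atlas R R 1 :=
  @Atlas R R 1 unit
         (fun _ => Chart setT (fun t : R => t%:M) (fun x : 'rV[R]_1 => x 0 0))
         (fun _ => tt).

Definition cosh (R : realType) (x : R) : R := (expR x + expR (- x)) / 2.
Definition sinh (R : realType) (x : R) : R := (expR x - expR (- x)) / 2.

(* The block decomposition is T(R x N) = span(d/dt) + TN. *)
Section LineProduct.
Variables (R : realType) (N : topologicalType) (m : nat) (A : atlas R N m).
Let LA := prod_atlas (line_atlas R) A.

Definition prod_phi (P : field A m m) : field LA (1 + m) (1 + m) :=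
  fun i p => block_mx 0 0 0 (P i.2 p.2).

Definition prod_xi : field LA 1 (1 + m) := fun _ _ => row_mx 1%:M 0.

Definition prod_eta : field LA (1 + m) 1 := fun _ _ => col_mx 1%:M 0.

Definition prod_metric (h ht : field A m m) : field LA (1 + m) (1 + m) :=
  fun i p => block_mx 1%:M 0 0
    (cosh (2 * p.1) *: h i.2 p.2 + sinh (2 * p.1) *: ht i.2 p.2).

End LineProduct.

Arguments prod_xi {R N m} A.
Arguments prod_eta {R N m} A.

(* Main.v *)
Require Import Defs.
From mathcomp Require Import ring lra measurable_realfun.

(** Both halves of the statement rest on the behaviour of the slice metrics
    [h_t = cosh(2t) h + sinh(2t) ht] on [N], where [ht(X, Y) = h(X, P Y)].

    As [P] is an isometry of [h] with [P^2 = 1], it is self-adjoint, so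
    [h_t(X, P Y) = sinh(2t) h + cosh(2t) ht =: k_t] is again symmetric and
    [d h_t / dt = 2 k_t] (here [k_t] is [slice_form]).  Since [P] is
    [h]-parallel, so is [ht], and every [h_t] has the Levi-Civita connection
    [D] of [h].  The Koszul formula for [g = dt^2 + h_t] then leaves
    [nabla_X Y = D_X Y - k_t(X, Y) d/dt], [nabla_X (d/dt) = nabla_(d/dt) X = P X]
    and [nabla_(d/dt) (d/dt) = 0] for [X], [Y] tangent to [N].  This is
    [prod_christoffel], and [levi_civita_prod] checks that it transforms as a
    connection, is torsion-free and preserves [g].  With [D P = 0] the
    derivative of [phi] collapses to
    [(nabla_X phi) Y = - k_t(X, P Y) d/dt = - h_t(X, Y) d/dt] and
    [(nabla_X phi) (d/dt) = - X], with [nabla_(d/dt) phi = 0]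
    ([nabla_prod_phi]), which are the para-Sasaki-like identities.

    For completeness, [ht] is bounded by [h], because [h(X + PX, X + PX)] and
    [h(X - PX, X - PX)] are nonnegative; hence
    [exp(-2|t|) h <= h_t <= exp(2|t|) h] ([slice_metric_bound]).  A curve of
    length [L] in the product changes [t] by at most [L] ([time_variation_le],
    by the fundamental theorem of calculus), so a short path that starts in a
    bounded range of [t] stays in a bounded range, and there its projection to
    [N] is longer by at most a constant factor ([project_path]).  A Cauchy
    sequence [(t_k, q_k)] therefore has [t_k] Cauchy in the real line and [q_k]
    Cauchy in [N].  With limits [t] and [q], moving first along the time axis
    from [(t_k, q_k)] to [(t, q_k)] and then inside the slice at time [t] gives
    [d((t_k, q_k), (t, q)) <= |t - t_k| + exp(|t|) d_h(q_k, q)]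
    ([dist_prod_le]), which tends to zero. *)

Set Implicit Arguments.
Unset Strict Implicit.
Unset Printing Implicit Defensive.

Import Order.TTheory GRing.Theory Num.Theory.
Import numFieldNormedType.Exports.

Local Open Scope classical_set_scope.
Local Open Scope ring_scope.

(** * Smooth functions and matrices *)

Lemma near_eq_continuous (T U : topologicalType) (f g : T -> U) x :
  (\forall y \near x, f y = g y) -> {for x, continuous f} -> {for x, continuous g}.
Proof.
move=> fg cf; rewrite /prop_for /continuous_at -(nbhs_singleton fg).
exact: cvg_trans (near_eq_cvg fg) cf.
Qed.

Section Smooth.
Variable R : realType.

Lemma differentiable_mx (V : normedModType R) r s (F : V -> 'M[R]_(r, s)) x :
  (forall b c, differentiable (fun y => F y b c) x) -> differentiable F x.
Proof.
move=> dF.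
have -> : F = \sum_(b < r) \sum_(c < s) (fun y => F y b c *: delta_mx b c).
  apply/funext => y; rewrite fct_sumE [LHS]matrix_sum_delta.
  by apply: eq_bigr => b _; rewrite fct_sumE.
apply: differentiable_sum => b; apply: differentiable_sum => c.
exact: (@differentiableZl _ _ _ (fun y => F y b c)).
Qed.

Lemma differentiable_near0 (V W : normedModType R) (f : V -> W) x :
  (\forall y \near x, f y = 0) -> differentiable f x.
Proof.
move=> f0; have fx0 := nbhs_singleton f0.
have e : f \o shift x = cst (f x) + (\0 : {linear V -> W}) +o_ 0 id.
  apply/eqaddoP => _/posnumP[e].
  have := f0; rewrite (near_shift 0) => f0'.
  apply: filterS f0' => y /=; rewrite subr0 => f0y.
  by rewrite !fctE /= fx0 f0y addr0 subr0 normr0 mulr_ge0.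
apply/diff_locallyP; rewrite (diff_unique _ e)//.
  by split=> // y; exact: cvg_cst.
by move=> y; exact: cvg_cst.
Qed.

(** The differential is a choice among candidates, so differentiability of [g] is
    obtained by adding to [f] a function that vanishes near [x]. *)
Lemma near_eq_differentiable (V W : normedModType R) (f g : V -> W) x :
  (\forall y \near x, f y = g y) -> differentiable f x -> differentiable g x.
Proof.
move=> fg df; rewrite (_ : g = f + (g - f)); last by rewrite addrC subrK.
apply: differentiableD => //; apply: differentiable_near0.
by apply: filterS fg => y fgy; rewrite !fctE fgy subrr.
Qed.

(** Openness of [U] matters: the derivatives at a point of [U] only see values in
    [U]. *)
Lemma Ck_eq m k (U : set 'rV[R]_m) f g : open U -> {in U, f =1 g} ->
  Ck k U f -> Ck k U g.
Proof.
move=> oU; have near_U h1 h2 x : {in U, h1 =1 h2} -> U x ->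
    \forall y \near x, h1 y = h2 y :> R.
  move=> hE Ux; apply: filterS (open_nbhs_nbhs (conj oU Ux)) => y Uy.
  by apply: hE; rewrite inE.
elim: k f g => [|k IH] f g fg /=.
  by move=> cf x Ux; exact: near_eq_continuous (near_U f g x fg Ux) (cf x Ux).
move=> [df Df]; split=> [x Ux|a].
  by apply: near_eq_differentiable (df x Ux); exact: near_U.
by apply: IH (Df a) => x; rewrite inE => Ux; apply: near_eq_derive; exact: near_U.
Qed.

Lemma Ck_cst m k (U : set 'rV[R]_m) c : Ck k U (cst c).
Proof.
elim: k c => [|k IH] c /=; first by move=> x _; exact: (@cst_continuous _ _ c).
split=> // a; rewrite (_ : (fun x => _) = cst 0)//.
by apply/funext => x; exact: derive_cst.
Qed.

Lemma CkS m k (U : set 'rV[R]_m) f : Ck k.+1 U f -> Ck k U f.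
Proof.
elim: k f => [|k IH] f [df Df]; last by split=> // a; exact: IH.
by move=> x /df /differentiable_continuous.
Qed.

Lemma CkD m k (U : set 'rV[R]_m) f g : open U ->
  Ck k U f -> Ck k U g -> Ck k U (f + g).
Proof.
move=> oU; elim: k f g => [|k IH] f g /=.
  by move=> cf cg x Ux; apply: continuousD; [exact: cf|exact: cg].
move=> [df Df] [dg Dg]; split=> [x Ux|a].
  by apply: differentiableD; [exact: df|exact: dg].
apply: (Ck_eq oU _ (IH _ _ (Df a) (Dg a))) => x /[!inE] Ux.
rewrite deriveD//; apply: diff_derivable; [exact: df|exact: dg].
Qed.

(** The Leibniz formula for the derivative of [f * g] only holds on [U], where
    [f] and [g] are differentiable; [Ck_eq] transfers the conclusion. *)
Lemma CkM m k (U : set 'rV[R]_m) f g : open U ->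
  Ck k U f -> Ck k U g -> Ck k U (f * g).
Proof.
move=> oU; elim: k f g => [|k IH] f g.
  by move=> cf cg x Ux; apply: continuousM; [exact: cf|exact: cg].
move=> Cf Cg; have [df Df] := Cf; have [dg Dg] := Cg; split=> [x Ux|a].
  by apply: differentiableM; [exact: df|exact: dg].
apply: (Ck_eq oU _ (CkD oU (IH _ _ (CkS Cf) (Dg a)) (IH _ _ (CkS Cg) (Df a)))).
move=> x /[!inE] Ux.
rewrite deriveM//; apply: diff_derivable; [exact: df|exact: dg].
Qed.

(** Reduces directional derivatives of explicit functions to one-variable
    calculus. *)
Lemma derive_line (V W : normedModType R) (f : V -> W) x v :
  'D_v f x = derive1 (fun h : R => f (h *: v + x)) 0.
Proof.
by rewrite /derive /derive1; congr (lim (_ @ 0^')); apply/funext => h /=;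
  rewrite addr0 scale0r add0r.
Qed.

(** The extra constant [d] makes the family closed under partial derivatives, so
    that the induction on [k] goes through. *)
Lemma Ck_expR_coord m k (U : set 'rV[R]_m) (a : 'I_m) c d :
  Ck k U (fun x => d * expR (c * x 0 a)).
Proof.
have dif x d' : differentiable (fun x : 'rV[R]_m => d' * expR (c * x 0 a)) x.
  apply: (@differentiableM _ _ (cst d')) => //.
  apply: (@differentiable_comp _ _ _ _ (fun x : 'rV[R]_m => c * x 0 a)).
    apply: (@differentiableM _ _ (cst c)) => //; exact: differentiable_coord.
  exact/derivable1_diffP/derivable_expR.
elim: k d => [|k IH] d /=.
  by move=> x _; apply: differentiable_continuous; exact: dif.
split=> [x _|b]; first exact: dif.
rewrite (_ : (fun x => _) =
  (fun x : 'rV[R]_m => (d * c * (b == a)%:R) * expR (c * x 0 a))) //.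
apply/funext => x; rewrite derive_line derive1E.
under eq_fun do rewrite !mxE eqxx /=.
rewrite derive_val scaler0 add0r addr0 mul0r add0r [_%:A]mulr1 eq_sym.
rewrite /GRing.scale/=.
ring.
Qed.

Lemma Ck_coord m k (U : set 'rV[R]_m) (a : 'I_m) : Ck k U (fun x => x 0 a).
Proof.
case: k => [|k] /=; first by move=> x _; exact: coord_continuous.
split=> [x _|b]; first exact: differentiable_coord.
rewrite (_ : (fun x => _) = cst (a == b)%:R); first exact: Ck_cst.
apply/funext => x; rewrite derive_line derive1E.
under eq_fun do rewrite !mxE eqxx /=.
by rewrite derive_val scaler0 add0r addr0 [_%:A]mulr1 eq_sym.
Qed.

(** Both sides are limits of the same difference quotient. *)
Lemma derive_linear (V W : normedModType R) (Z : normedModType R)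
  (L : {linear V -> W}) (f : W -> Z) x v : 'D_v (f \o L) x = 'D_(L v) f (L x).
Proof.
rewrite /derive; congr (lim (_ @ 0^')); apply/funext => h /=.
by rewrite [L (_ + _)]linearD [L (_ *: _)]linearZ.
Qed.

Lemma rsubmx_delta_lshift m1 m2 (a : 'I_m1) :
  rsubmx (delta_mx 0 (lshift m2 a) : 'rV[R]_(m1 + m2)) = 0.
Proof. by apply/rowP => b; rewrite !mxE eqxx eq_rlshift. Qed.

Lemma rsubmx_delta_rshift m1 m2 (a : 'I_m2) :
  rsubmx (delta_mx 0 (rshift m1 a) : 'rV[R]_(m1 + m2)) = delta_mx 0 a.
Proof. by apply/rowP => b; rewrite !mxE eqxx eq_rshift. Qed.

(** Pulling back along the projection [R^(m1 + m2) -> R^m2]: derivatives along the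
    first factor vanish, the others are pullbacks. *)
Lemma Ck_rsubmx m1 m2 k (U : set 'rV[R]_m2) f :
  Ck k U f -> Ck k ((rsubmx : 'rV[R]_(m1 + m2) -> _) @^-1` U) (f \o rsubmx).
Proof.
elim: k f => [|k IH] f /=.
  move=> cf x Ux; rewrite /prop_for /continuous_at /=.
  exact: (continuous_comp (@continuous_rsubmx R 1 m1 m2 x) (cf _ Ux)).
move=> [df Df]; split=> [x Ux|a].
  by apply: differentiable_comp; [exact: differentiable_rsubmx|exact: df].
rewrite (_ : (fun x => _) = (fun x => 'D_(rsubmx (delta_mx 0 a)) f (rsubmx x))).
  case: (split_ordP a) => b ->.
    rewrite rsubmx_delta_lshift (_ : (fun x => _) = cst 0); first exact: Ck_cst.
    by apply/funext => x; rewrite derive0.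
  by rewrite rsubmx_delta_rshift; exact: (IH _ (Df b)).
apply/funext => x; exact: (derive_linear _ f).
Qed.

Definition smooth_mx m r s (U : set 'rV[R]_m) (F : 'rV[R]_m -> 'M[R]_(r, s)) :=
  forall b c, smooth_on U (fun x => F x b c).

Section SmoothMx.
Variables (m : nat) (U : set 'rV[R]_m).
Hypothesis oU : open U.

Lemma smooth_on_cst c : smooth_on U (cst c).
Proof. by move=> k; exact: Ck_cst. Qed.

Lemma smooth_onD f g : smooth_on U f -> smooth_on U g -> smooth_on U (f + g).
Proof. by move=> sf sg k; exact: CkD. Qed.

Lemma smooth_onM f g : smooth_on U f -> smooth_on U g -> smooth_on U (f * g).
Proof. by move=> sf sg k; exact: CkM. Qed.

Lemma smooth_on_sum (I : finType) (F : I -> 'rV[R]_m -> R) :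
  (forall i, smooth_on U (F i)) -> smooth_on U (fun x => \sum_i F i x).
Proof.
move=> sF; rewrite (_ : (fun x => _) = \sum_i F i).
  by apply: (big_ind (smooth_on U)) => //;
    [exact: smooth_on_cst|exact: smooth_onD].
by apply/funext => x; rewrite fct_sumE.
Qed.

Lemma smooth_mx_cst r s (C : 'M[R]_(r, s)) : smooth_mx U (cst C).
Proof. by move=> b c; exact: (smooth_on_cst (C b c)). Qed.

Lemma smooth_mxD r s (F G : _ -> 'M[R]_(r, s)) :
  smooth_mx U F -> smooth_mx U G -> smooth_mx U (fun x => F x + G x).
Proof.
move=> sF sG b c; under eq_fun do rewrite mxE.
exact: (smooth_onD (sF b c) (sG b c)).
Qed.

Lemma smooth_mxZ r s f (F : _ -> 'M[R]_(r, s)) :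
  smooth_on U f -> smooth_mx U F -> smooth_mx U (fun x => f x *: F x).
Proof.
move=> sf sF b c; under eq_fun do rewrite mxE.
exact: (smooth_onM sf (sF b c)).
Qed.

Lemma smooth_mxM r s t (F : _ -> 'M[R]_(r, s)) (G : _ -> 'M[R]_(s, t)) :
  smooth_mx U F -> smooth_mx U G -> smooth_mx U (fun x => F x *m G x).
Proof.
move=> sF sG b c; under eq_fun do rewrite mxE.
apply: smooth_on_sum => a; exact: (smooth_onM (sF b a) (sG a c)).
Qed.

Lemma smooth_mx_tr r s (F : _ -> 'M[R]_(r, s)) :
  smooth_mx U F -> smooth_mx U (fun x => (F x)^T).
Proof. by move=> sF b c; under eq_fun do rewrite mxE; exact: sF. Qed.

Lemma smooth_mx_row r s (F : _ -> 'M[R]_(r, s)) a :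
  smooth_mx U F -> smooth_mx U (fun x => row a (F x)).
Proof. by move=> sF b c; under eq_fun do rewrite mxE; exact: sF. Qed.

Lemma smooth_mx_block r1 r2 s1 s2 (F1 : _ -> 'M[R]_(r1, s1)) F2 F3
    (F4 : _ -> 'M[R]_(r2, s2)) :
  smooth_mx U F1 -> smooth_mx U F2 -> smooth_mx U F3 -> smooth_mx U F4 ->
  smooth_mx U (fun x => block_mx (F1 x) (F2 x) (F3 x) (F4 x)).
Proof.
move=> s1F s2F s3F s4F b c.
case: (split_ordP b) => b' ->; case: (split_ordP c) => c' ->.
- by under eq_fun do rewrite block_mxEul; exact: s1F.
- by under eq_fun do rewrite block_mxEur; exact: s2F.
- by under eq_fun do rewrite block_mxEdl; exact: s3F.
- by under eq_fun do rewrite block_mxEdr; exact: s4F.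
Qed.

End SmoothMx.

End Smooth.

(** * The product manifold *)

Section ProductTopology.

Lemma open_setX_prod (T U : topologicalType) (A : set T) (B : set U) :
  open A -> open B -> open (A `*` B).
Proof.
rewrite !openE => oA oB [p q] [/= /oA Ap /oB Bq].
by exists (A, B).
Qed.

Lemma hausdorff_prod (T U : topologicalType) :
  hausdorff_space T -> hausdorff_space U -> hausdorff_space (T * U)%type.
Proof.
move=> hT hU [p1 p2] [q1 q2] pq; congr pair.
- apply: hT => B C pB qC.
  have [||[x1 x2] [/= [Bx _] [Cx _]]] := pq (B `*` setT) (C `*` setT).
  + by exists (B, setT) => //; split=> //; exact: filterT.
  + by exists (C, setT) => //; split=> //; exact: filterT.
  by exists x1.
- apply: hU => B C pB qC.
  have [||[x1 x2] [/= [_ Bx] [_ Cx]]] := pq (setT `*` B) (setT `*` C).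
  + by exists (setT, B) => //; split=> //; exact: filterT.
  + by exists (setT, C) => //; split=> //; exact: filterT.
  by exists x2.
Qed.

Lemma second_countable_prod (T U : topologicalType) :
  @second_countable T -> @second_countable U -> @second_countable (T * U)%type.
Proof.
move=> [B cB [oB bB]] [C cC [oC bC]].
exists ((fun D : set T * set U => D.1 `*` D.2) @` (B `*` C)).
  apply: (@sub_countable _ _ _ (B `*` C)); first exact: card_image_le.
  exact: countableX.
split=> [_ [[D E] /= [BD CE] <-]|[p q] /= W [[P Q] [/= pP qQ] PQW]].
  by apply: open_setX_prod; [exact: oB|exact: oC].
have [D [BD Dp] DP] := bB p _ pP; have [E [CE Eq] EQ] := bC q _ qQ.
exists (D `*` E); last by move=> [x y] [/= /DP Px /EQ Qy]; exact: PQW.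
by split=> //; exists (D, E).
Qed.

(** Open intervals with rational endpoints form a countable basis. *)
Lemma second_countable_real (R : realType) : @second_countable R.
Proof.
exists ((fun q : rat * rat => `]ratr q.1, ratr q.2[%classic : set R) @` setT).
  apply: (@sub_countable _ _ _ [set: rat * rat]); first exact: card_image_le.
  exact: countableP.
split=> [_ [[p q] _ <-]|x W /nbhs_ballP[e /= e0 eW]]; first exact: interval_open.
have [p px] : exists p : rat, ratr p \in `]x - e, x[.
  by apply: rat_in_itvoo; rewrite ltrBlDr ltrDl.
have [q qx] : exists q : rat, ratr q \in `]x, x + e[.
  by apply: rat_in_itvoo; rewrite ltrDl.
exists `]ratr p, ratr q[%classic.
  split; first by exists (p, q).
  move: px qx; rewrite !in_itv /= => /andP[_ px] /andP[xq _].
  by rewrite in_itv /= px xq.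
move=> y; rewrite /= in_itv /= => /andP[py yq]; apply: eW.
move: px qx; rewrite !in_itv /= => /andP[px _] /andP[_ xq].
rewrite /ball /= ltr_distlC; apply/andP; split; first exact: lt_trans px py.
exact: lt_trans yq xq.
Qed.

End ProductTopology.

Section ProductChart.
Variable R : realType.

(** A basic neighbourhood of a row matrix is a box of neighbourhoods of its
    entries, which splits into one box for each block. *)
Lemma continuous_row_mx (T : topologicalType) r m1 m2 (f : T -> 'M[R]_(r, m1))
    (g : T -> 'M[R]_(r, m2)) p :
  {for p, continuous f} -> {for p, continuous g} ->
  {for p, continuous (fun x => row_mx (f x) (g x))}.
Proof.
move=> cf cg W [P /= nP PW].
have nf : nbhs (f p) [set M | forall i j, P i (lshift m2 j) (M i j)].
  exists (fun i j => P i (lshift m2 j)) => // i j.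
  by move: (nP i (lshift m2 j)); rewrite row_mxEl.
have ng : nbhs (g p) [set M | forall i j, P i (rshift m1 j) (M i j)].
  exists (fun i j => P i (rshift m1 j)) => // i j.
  by move: (nP i (rshift m1 j)); rewrite row_mxEr.
suff : nbhs p ((fun x => row_mx (f x) (g x)) @^-1` W) by [].
have {}nf : nbhs p (f @^-1` _) := cf _ nf.
have {}ng : nbhs p (g @^-1` _) := cg _ ng.
apply: filterS (filterI nf ng) => x [/= fP gP]; apply: PW => i j.
by case: (split_ordP j) => k ->; rewrite ?row_mxEl ?row_mxEr.
Qed.

Lemma continuous_scalar_mx11 : continuous (fun t : R => t%:M : 'rV[R]_1).
Proof.
move=> t W [P /= nP PW].
have := nP 0 0; rewrite mxE eqxx mulr1n => n00.
suff : nbhs t ((fun t : R => t%:M : 'rV[R]_1) @^-1` W) by [].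
apply: filterS n00 => s Ps; apply: PW => i j.
by rewrite !ord1 mxE eqxx mulr1n.
Qed.

Variables (N : topologicalType) (m : nat) (A : atlas R N m).
Let LA := prod_atlas (line_atlas R) A.

(** The line has a single chart with image all of R, so coordinate images in the
    product are cylinders over those in [N]. *)
Lemma coord_image_cylinder (i : index LA) (W : set N) :
  coord (LA i) @` (setT `*` W) = rsubmx @^-1` (coord (A i.2) @` W).
Proof.
apply/seteqP; split=> [_ [[t q] [_ /= Wq] <-]|x /= [q Wq qx]].
  by rewrite row_mxKr; exists q.
exists (lsubmx x 0 0, q) => //=.
by rewrite qx -mx11_scalar hsubmxK.
Qed.

Lemma dom_prod i : dom (LA i) = setT `*` dom (A i.2).
Proof. by []. Qed.

Lemma overlap_prod i j : overlap (A := LA) i j = setT `*` overlap i.2 j.2.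
Proof.
by apply/seteqP; split=> [[t q] [[_ ?] [_ ?]]|[t q] [_ [? ?]]].
Qed.

Lemma chart_img_prod i : chart_img (LA i) = rsubmx @^-1` chart_img (A i.2).
Proof. exact: coord_image_cylinder. Qed.

Lemma open_rsubmx (U : set 'rV[R]_m) : open U ->
  open ((rsubmx : 'rV[R]_(1 + m) -> _) @^-1` U).
Proof.
by move=> oU; apply: open_comp => // x _; exact: continuous_rsubmx.
Qed.

Lemma is_chart_prod i : is_chart (A i.2) -> is_chart (LA i).
Proof.
move=> [od oi pK cc cp]; split.
- by rewrite dom_prod; apply: open_setX_prod => //; exact: openT.
- by rewrite chart_img_prod; exact: open_rsubmx.
- move=> [t q] [_ /= dq]; rewrite row_mxKl row_mxKr pK//.
  by rewrite mxE eqxx mulr1n.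
- move=> [t q] [_ /= dq]; apply: continuous_row_mx.
    apply: (@continuous_comp _ _ _ fst (fun t : R => t%:M : 'rV[R]_1)).
      exact: cvg_fst.
    exact: continuous_scalar_mx11.
  apply: (@continuous_comp _ _ _ snd (coord (A i.2))); first exact: cvg_snd.
  exact: cc.
- move=> x; rewrite chart_img_prod /= => ix.
  have h1 : {for x, continuous (fun x : 'rV[R]_(1 + m) => lsubmx x 0 0)}.
    apply: (@continuous_comp _ _ _ lsubmx (fun y : 'rV[R]_1 => y 0 0)).
      exact: continuous_lsubmx.
    exact: coord_continuous.
  have h2 : {for x,
      continuous (fun x : 'rV[R]_(1 + m) => param (A i.2) (rsubmx x))}.
    apply: (@continuous_comp _ _ _ rsubmx (param (A i.2))).
      exact: continuous_rsubmx.
    exact: cp.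
  exact: (cvg_pair h1 h2).
Qed.

Lemma smooth_manifold_prod : smooth_manifold A -> smooth_manifold LA.
Proof.
move=> [hN sN cA dA tA]; split.
- by apply: hausdorff_prod => //; exact: Rhausdorff.
- by apply: second_countable_prod => //; exact: second_countable_real.
- by move=> i; exact: is_chart_prod.
- by move=> [t q]; split=> //=; exact: dA.
move=> i j b; rewrite [dom _ `&` _](overlap_prod i j) coord_image_cylinder => k.
case: (split_ordP b) => b' ->.
  rewrite (_ : (fun x => _) = (fun x : 'rV[R]_(1 + m) => x 0 (lshift m 0))).
    exact: Ck_coord.
  by apply/funext => x; rewrite /= row_mxEl !ord1 !mxE eqxx.
rewrite (_ : (fun x => _) =
  (fun y => coord (A j.2) (param (A i.2) y) 0 b') \o rsubmx).
  exact: (@Ck_rsubmx R 1 m k _ _ (tA i.2 j.2 b' k)).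
by apply/funext => x; rewrite /= row_mxEr.
Qed.

End ProductChart.

(** * Partial derivatives on the product *)

Lemma eq_derive (R : numFieldType) (V W : normedModType R) (f g : V -> W) x v :
  f =1 g -> 'D_v f x = 'D_v g x.
Proof. by move=> /funext ->. Qed.

Section PartialDerivatives.
Variables (R : realType) (M : topologicalType) (m : nat) (A : atlas R M m).
Implicit Types (i j : index A) (a : 'I_m) (p : M).

(** The pointwise form of smoothness under which the Leibniz rules for [pd] hold. *)
Definition chart_differentiable i r s (T : M -> 'M[R]_(r, s)) p :=
  forall b c, differentiable (fun x => T (param (A i) x) b c) (coord (A i) p).

Lemma smooth_chart_differentiable r s (T : field A r s) i p :
  smooth_field T -> dom (A i) p -> chart_differentiable i (T i) p.
Proof.
move=> sT dp b c; have [dT _] := sT i b c 1%N; apply: dT.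
by exists p.
Qed.

(** Needed because formulas such as that of [jac_prod] only hold on overlaps. *)
Lemma pd_eq i a r s (S T : M -> 'M[R]_(r, s)) p (W : set M) :
  is_chart (A i) -> dom (A i) p -> open W -> W p -> {in W, S =1 T} ->
  pd i a S p = pd i a T p.
Proof.
move=> [_ _ pK _ cp] dp oW Wp ST; apply/matrixP => b c; rewrite !mxE.
apply: near_eq_derive.
have ip : chart_img (A i) (coord (A i) p) by exists p.
have nW : nbhs (param (A i) (coord (A i) p)) W.
  by rewrite pK//; exact: open_nbhs_nbhs.
have : nbhs (coord (A i) p) (param (A i) @^-1` W) := cp _ ip _ nW.
by apply: filterS => x Wx; rewrite ST// inE.
Qed.

Lemma pd_cst i a r s (C : 'M[R]_(r, s)) p : pd i a (cst C) p = 0.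
Proof. by apply/matrixP => b c; rewrite !mxE derive_cst. Qed.

Lemma pdD i a r s (S T : M -> 'M[R]_(r, s)) p :
  chart_differentiable i S p -> chart_differentiable i T p ->
  pd i a (fun q => S q + T q) p = pd i a S p + pd i a T p.
Proof.
move=> dS dT; apply/matrixP => b c; rewrite !mxE.
rewrite -deriveD; [|exact: diff_derivable (dS b c)|exact: diff_derivable (dT b c)].
by apply: eq_derive => x; rewrite mxE.
Qed.

Lemma pdZ i a r s k (T : M -> 'M[R]_(r, s)) p : chart_differentiable i T p ->
  pd i a (fun q => k *: T q) p = k *: pd i a T p.
Proof.
move=> dT; apply/matrixP => b c; rewrite !mxE.
rewrite -[RHS]/(k *: 'D_(delta_mx 0 a) (fun x => T (param (A i) x) b c) _).
rewrite -deriveZ; last exact: diff_derivable (dT b c).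
by apply: eq_derive => x; rewrite mxE.
Qed.

Lemma pdM i a r s t (S : M -> 'M[R]_(r, s)) (T : M -> 'M[R]_(s, t)) p :
  is_chart (A i) -> dom (A i) p ->
  chart_differentiable i S p -> chart_differentiable i T p ->
  pd i a (fun q => S q *m T q) p = pd i a S p *m T p + S p *m pd i a T p.
Proof.
move=> [_ _ pK _ _] dp dS dT; apply/matrixP => b c; rewrite !mxE.
under eq_fun do rewrite mxE.
rewrite (_ : (fun x => _) = \sum_d
   ((fun x => S (param (A i) x) b d) * (fun x => T (param (A i) x) d c))).
  rewrite derive_sum => [|d]; last first.
    by apply: derivableM; exact: diff_derivable.
  rewrite -big_split; apply: eq_bigr => d _ /=.
  rewrite deriveM; [|exact: diff_derivable (dS b d)|exact: diff_derivable (dT d c)].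
  by rewrite !mxE pK// addrC; congr (_ + _); exact: mulrC.
by apply/funext => x; rewrite fct_sumE.
Qed.

Lemma pd_tr i a r s (T : M -> 'M[R]_(r, s)) p :
  pd i a (fun q => (T q)^T) p = (pd i a T p)^T.
Proof.
by apply/matrixP => b c; rewrite !mxE; apply: eq_derive => x; rewrite mxE.
Qed.

Lemma pd_block i a r1 r2 s1 s2 (T1 : M -> 'M[R]_(r1, s1)) T2 T3
    (T4 : M -> 'M[R]_(r2, s2)) p :
  pd i a (fun q => block_mx (T1 q) (T2 q) (T3 q) (T4 q)) p =
  block_mx (pd i a T1 p) (pd i a T2 p) (pd i a T3 p) (pd i a T4 p).
Proof.
apply/matrixP => b c; rewrite mxE.
case: (split_ordP b) => b' ->; case: (split_ordP c) => c' ->;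
  rewrite ?block_mxEul ?block_mxEur ?block_mxEdl ?block_mxEdr mxE;
  by apply: eq_derive => x;
    rewrite ?block_mxEul ?block_mxEur ?block_mxEdl ?block_mxEdr.
Qed.

Lemma transition_differentiable i j p : smooth_manifold A -> overlap i j p ->
  differentiable (coord (A j) \o param (A i)) (coord (A i) p).
Proof.
move=> [_ _ _ _ tA] ov; apply: differentiable_mx => b c.
have [dT _] := tA i j c 1%N; rewrite ord1; apply: dT.
by exists p.
Qed.

(** The Jacobian consists of partial derivatives of coordinates, which brings
    Jacobians of the product under [pd_time] and [pd_space]. *)
Lemma jacE i j p : smooth_manifold A -> overlap i j p ->
  jac i j p = \matrix_(a, b) pd i a (coord (A j)) p 0 b.
Proof.
move=> sA ov; have dF := transition_differentiable sA ov.
apply/matrixP => a b; rewrite !mxE.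
have : 'D_(delta_mx 0 a) (coord (A j) \o param (A i)) (coord (A i) p) =
   delta_mx 0 a *m jac i j p by exact: deriveEjacobian.
rewrite derive_mx; last exact: diff_derivable.
by move/rowP/(_ b); rewrite -rowE !mxE.
Qed.

End PartialDerivatives.

Section ProductDerivatives.
Variables (R : realType) (N : topologicalType) (m : nat) (A : atlas R N m).
Let LA := prod_atlas (line_atlas R) A.
Hypothesis sA : smooth_manifold A.
Implicit Types (i j : index LA) (p : R * N).

Lemma param_time i h p : dom (A i.2) p.2 ->
  param (LA i) (h *: delta_mx 0 (lshift m 0) + coord (LA i) p) = (h + p.1, p.2).
Proof.
case: sA => _ _ cA _ _; case: (cA i.2) => _ _ pK _ _ dp.
rewrite /= delta_mx_lshift scale_row_mx add_row_mx row_mxKl row_mxKr.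
by rewrite scaler0 add0r pK// !mxE !eqxx mulr1 mulr1n.
Qed.

Lemma param_space i h (a : 'I_m) p :
  param (LA i) (h *: delta_mx 0 (rshift 1 a) + coord (LA i) p) =
  (p.1, param (A i.2) (h *: delta_mx 0 a + coord (A i.2) p.2)).
Proof.
rewrite /= delta_mx_rshift scale_row_mx add_row_mx row_mxKl row_mxKr.
by rewrite scaler0 add0r mxE eqxx mulr1n.
Qed.

Lemma coordK_prod i p : dom (A i.2) p.2 -> param (LA i) (coord (LA i) p) = p.
Proof.
by move=> /(param_time 0); rewrite scale0r !add0r => ->; case: p.
Qed.

Lemma pd_time i r s (T : R * N -> 'M[R]_(r, s)) p : dom (A i.2) p.2 ->
  pd i (lshift m 0) T p =
  \matrix_(b, c) derive1 (fun t => T (t, p.2) b c) p.1.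
Proof.
move=> dp; apply/matrixP => b c; rewrite [LHS]mxE [RHS]mxE /derive /derive1.
congr (lim (_ @ 0^')); apply/funext => h.
by rewrite [(_ \o _) _]/(T (param (LA i) _) b c) param_time// coordK_prod//;
  case: p dp.
Qed.

Lemma pd_space i (a : 'I_m) r s (T : R * N -> 'M[R]_(r, s)) p :
  pd i (rshift 1 a) T p = pd i.2 a (fun q => T (p.1, q)) p.2.
Proof.
apply/matrixP => b c; rewrite [LHS]mxE [RHS]mxE /derive.
congr (lim (_ @ 0^')); apply/funext => h.
rewrite [(_ \o _) (_ *: delta_mx _ (rshift _ _))]/(T (param (LA i) _) b c).
rewrite param_space.
have := param_space i 0 a p; rewrite !scale0r !add0r => ->.
by [].
Qed.

Lemma jac_prod i j p : overlap i j p ->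
  jac i j p = block_mx 1%:M 0 0 (jac i.2 j.2 p.2).
Proof.
move=> ov; have ov2 : overlap i.2 j.2 p.2 by move: ov; rewrite overlap_prod => -[].
have sLA := smooth_manifold_prod sA.
rewrite (jacE sLA ov) (jacE sA ov2); apply/matrixP => a b; rewrite mxE.
case: (split_ordP a) => a' ->.
  rewrite !ord1 pd_time; last by case: ov2.
  case: (split_ordP b) => b' ->; rewrite mxE /=.
    rewrite block_mxEul !ord1 mxE eqxx derive1E.
    by under eq_fun do rewrite row_mxEl mxE eqxx; rewrite derive_id.
  rewrite block_mxEur mxE.
  by under eq_fun do rewrite row_mxEr; rewrite derive1_cst.
rewrite pd_space; case: (split_ordP b) => b' ->; rewrite mxE /=.
  rewrite block_mxEdl mxE.
  under eq_fun do rewrite row_mxEl.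
  exact: derive_cst.
rewrite block_mxEdr !mxE.
by under eq_fun do rewrite row_mxEr.
Qed.

Lemma smooth_field_snd r s (T : field A r s) i : smooth_field T ->
  smooth_mx (chart_img (LA i)) (fun x => T i.2 (param (LA i) x).2).
Proof.
move=> sT b c k; rewrite chart_img_prod.
exact: (@Ck_rsubmx R 1 m k _ _ (sT i.2 b c k)).
Qed.

Lemma smooth_time_expR i c : smooth_on (chart_img (LA i))
  (fun x => expR (c * (param (LA i) x).1)).
Proof.
move=> k; rewrite (_ : (fun x => _) =
  (fun x : 'rV[R]_(1 + m) => 1 * expR (c * x 0 (lshift m 0)))).
  exact: Ck_expR_coord.
by apply/funext => x; rewrite /= mxE mul1r.
Qed.

Lemma smooth_cosh i : smooth_on (chart_img (LA i))
  (fun x => cosh (2 * (param (LA i) x).1)).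
Proof.
have oU : open (chart_img (LA i)).
  by case: (smooth_manifold_prod sA) => _ _ /(_ i) [].
rewrite (_ : (fun x => _) = ((fun x => expR (2 * (param (LA i) x).1)) +
   (fun x => expR (- 2 * (param (LA i) x).1))) * cst (2^-1)).
  apply: smooth_onM => //; last exact: smooth_on_cst.
  by apply: smooth_onD => //; exact: smooth_time_expR.
by apply/funext => x; rewrite !fctE /cosh mulNr.
Qed.

Lemma smooth_sinh i : smooth_on (chart_img (LA i))
  (fun x => sinh (2 * (param (LA i) x).1)).
Proof.
have oU : open (chart_img (LA i)).
  by case: (smooth_manifold_prod sA) => _ _ /(_ i) [].
rewrite (_ : (fun x => _) = ((fun x => expR (2 * (param (LA i) x).1)) +
   cst (-1) * (fun x => expR (- 2 * (param (LA i) x).1))) * cst (2^-1)).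
  apply: smooth_onM => //; last exact: smooth_on_cst.
  apply: smooth_onD => //; first exact: smooth_time_expR.
  by apply: smooth_onM => //; [exact: smooth_on_cst|exact: smooth_time_expR].
by apply/funext => x; rewrite !fctE /sinh mulNr mulN1r.
Qed.

End ProductDerivatives.

(** * Bilinear forms and involutions *)

Section LinearAlgebra.
Variable R : realType.

Lemma bil_delta m (G : 'M[R]_m) a b : bil G (delta_mx 0 a) (delta_mx 0 b) = G a b.
Proof. by rewrite /bil -rowE trmx_delta -colE !mxE. Qed.

Lemma bil_inj m (G H : 'M[R]_m) : bil G =2 bil H -> G = H.
Proof. by move=> GH; apply/matrixP => a b; rewrite -!bil_delta GH. Qed.

Lemma bilDl m (G : 'M[R]_m) x y z : bil G (x + y) z = bil G x z + bil G y z.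
Proof. by rewrite /bil !mulmxDl mxE. Qed.

Lemma bilDr m (G : 'M[R]_m) x y z : bil G z (x + y) = bil G z x + bil G z y.
Proof. by rewrite /bil linearD /= !mulmxDr mxE. Qed.

Lemma bilNl m (G : 'M[R]_m) x z : bil G (- x) z = - bil G x z.
Proof. by rewrite /bil !mulNmx mxE. Qed.

Lemma bilNr m (G : 'M[R]_m) x z : bil G z (- x) = - bil G z x.
Proof. by rewrite /bil linearN /= !mulmxN mxE. Qed.

Lemma bil_metricD m (G H : 'M[R]_m) x y : bil (G + H) x y = bil G x y + bil H x y.
Proof. by rewrite /bil mulmxDr mulmxDl mxE. Qed.

Lemma bil_metricZ m c (G : 'M[R]_m) x y : bil (c *: G) x y = c * bil G x y.
Proof. by rewrite /bil -scalemxAr -scalemxAl mxE. Qed.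

Lemma bil_sym m (G : 'M[R]_m) x y : G^T = G -> bil G x y = bil G y x.
Proof.
move=> sG; rewrite /bil; have -> : x *m G *m y^T = (y *m G *m x^T)^T.
  by rewrite !trmx_mul trmxK sG mulmxA.
by rewrite mxE.
Qed.

Lemma bil_block m (G : 'M[R]_m) (x1 y1 : 'rV[R]_1) x2 y2 :
  bil (block_mx 1%:M 0 0 G) (row_mx x1 x2) (row_mx y1 y2) =
  x1 0 0 * y1 0 0 + bil G x2 y2.
Proof.
rewrite /bil mul_row_block !mulmx0 mulmx1 add0r addr0 tr_row_mx mul_row_col mxE.
by rewrite mxE big_ord1 mxE.
Qed.

(** Cancel [C] on the left and [B] on the right in [C B C B = C B]. *)
Lemma idempotent_factorization (F : fieldType) m r (C : 'M[F]_(m, r))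
    (B : 'M[F]_(r, m)) :
  row_full C -> row_free B -> C *m B *m (C *m B) = C *m B -> B *m C = 1%:M.
Proof.
move=> /row_fullP[L LC] /row_freeP[Q BQ] CBCB.
transitivity (L *m (C *m B *m (C *m B)) *m Q).
  by rewrite !mulmxA LC mul1mx -!mulmxA BQ mulmx1.
by rewrite CBCB !mulmxA LC mul1mx BQ.
Qed.

(** Writing [E = C B] with [C] of full column rank and [B] of full row rank,
    [tr E = tr (B C)] is the trace of an identity matrix of size the rank. *)
Lemma mxtrace_idempotent (F : fieldType) m (E : 'M[F]_m) :
  E *m E = E -> \tr E = (\rank E)%:R.
Proof.
move=> EE; rewrite -[in LHS](mulmx_base E) mxtrace_mulC.
rewrite idempotent_factorization ?mxtrace1 ?col_base_full ?row_base_free//.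
by rewrite !mulmx_base.
Qed.

(** The eigenspace is the kernel of [P - a], a multiple of the projection
    [E = (1 - a P) / 2].  The rank of [E] is its trace, which is [n] as [tr P = 0],
    so the kernel has dimension [n] too. *)
Lemma rank_eigenspace_involution n (P : 'M[R]_n.*2) (a : R) :
  a ^+ 2 = 1 -> P *m P = 1%:M -> \tr P = 0 -> \rank (eigenspace P a) = n.
Proof.
move=> aa PP trP; rewrite /eigenspace mxrank_ker.
pose E : 'M[R]_n.*2 := 2^-1 *: (1%:M - a *: P).
have rE : \rank (P - a%:M) = \rank E.
  have -> : P - a%:M = (- 2 * a) *: E.
    rewrite /E scalerA scalerBr scalerA.
    have -> : - 2 * a / 2 = - a by field.
    have -> : - a * a = - 1 by rewrite mulNr -expr2 aa.
    by rewrite scaleN1r opprK scaleNr addrC scalemx1.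
  rewrite mxrank_scale_nz// mulf_neq0// ?oppr_eq0 ?pnatr_eq0//.
  apply/eqP => a0; move: aa; rewrite a0 expr0n /= => /eqP.
  by rewrite eq_sym oner_eq0.
have QQ : (a *: P) *m (a *: P) = 1%:M.
  by rewrite -scalemxAl -scalemxAr scalerA -expr2 aa PP scale1r.
have EE : E *m E = E.
  rewrite /E -scalemxAl -scalemxAr mulmxBl mul1mx mulmxBr mulmx1 QQ opprB.
  rewrite -mulr2n -[(_ - _) *+ 2]scaler_nat !scalerA -mulrA mulVf.
    by rewrite mulr1.
  by rewrite pnatr_eq0.
have n2 : (n.*2)%:R = 2 * n%:R :> R by rewrite -mul2n natrM.
have := mxtrace_idempotent EE.
rewrite {1}/E linearZ linearB linearZ /= trP mulr0 subr0 mxtrace1 n2.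
rewrite mulKf ?pnatr_eq0// => /eqP; rewrite eqr_nat => /eqP nE.
by rewrite rE -nE -addnn addnK.
Qed.

(** Horizontal vectors are the row vectors with vanishing time component. *)
Lemma rank_horizontal_eigenspace m (P : 'M[R]_m) (a : R) :
  \rank (eigenspace (block_mx 0 0 0 P : 'M[R]_(1 + m)) a :&:
         kermx (col_mx 1%:M 0 : 'M[R]_(1 + m, 1)))%MS = \rank (eigenspace P a).
Proof.
set E := eigenspace P a; rewrite -(rank_row_0mx 1 E).
apply: eqmx_rank; apply/andP; split.
  apply/rV_subP => v; rewrite sub_capmx => /andP[/eigenspaceP vP /sub_kermxP v0].
  have := v0; rewrite -[v]hsubmxK mul_row_col mulmx1 mulmx0 addr0 => v00.
  move: vP; rewrite -[v]hsubmxK v00 mul_row_block !mulmx0 ?mul0mx !add0r.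
  rewrite scale_row_mx => /eq_row_mx[_] /eigenspaceP /submxP[Q ->].
  by apply/submxP; exists Q; rewrite mul_mx_row mulmx0 hsubmxK.
rewrite sub_capmx; apply/andP; split.
  apply/eigenspaceP; rewrite mul_row_block !mulmx0 !add0r scale_row_mx scaler0.
  by rewrite ?mul0mx; congr row_mx; exact/eigenspaceP.
by apply/sub_kermxP; rewrite mul_row_col mul0mx mulmx0 addr0.
Qed.

End LinearAlgebra.

(** * The almost paracontact structure *)

Section Hyperbolic.
Variable R : realType.
Implicit Types t : R.

Lemma derive1_cosh2 t : derive1 (fun t : R => cosh (2 * t)) t = 2 * sinh (2 * t).
Proof.
rewrite /cosh /sinh derive1E.
by rewrite derive_val /GRing.scale/= !mulr1 !mulr0; field.
Qed.

Lemma derive1_sinh2 t : derive1 (fun t : R => sinh (2 * t)) t = 2 * cosh (2 * t).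
Proof.
rewrite /cosh /sinh derive1E.
by rewrite derive_val /GRing.scale/= !mulr1 !mulr0; field.
Qed.

Lemma derivable_cosh2 t : derivable (fun t : R => cosh (2 * t)) t 1.
Proof. by rewrite /cosh; exact: ex_derive. Qed.

Lemma derivable_sinh2 t : derivable (fun t : R => sinh (2 * t)) t 1.
Proof. by rewrite /sinh; exact: ex_derive. Qed.

(** The middle term is [(e^(2t) (H + S) + e^(-2t) (H - S)) / 2], with both
    [H + S] and [H - S] nonnegative and of sum [2 H]. *)
Lemma cosh_sinh_bound (t H S : R) : `|S| <= H ->
  expR (- (2 * `|t|)) * H <= cosh (2 * t) * H + sinh (2 * t) * S <=
  expR (2 * `|t|) * H.
Proof.
rewrite ler_norml => /andP[HS SH].
have e0 : 0 < expR (2 * t) by exact: expR_gt0.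
have e1 : 0 < expR (- (2 * t)) by exact: expR_gt0.
rewrite /cosh /sinh.
have [t0|t0] := leP 0 t.
- have ee : expR (- (2 * t)) <= expR (2 * t) by rewrite ler_expR; lra.
  rewrite ger0_norm//; apply/andP; split; nra.
- have ee : expR (2 * t) <= expR (- (2 * t)) by rewrite ler_expR; lra.
  rewrite ltr0_norm// mulrN opprK; apply/andP; split; nra.
Qed.

End Hyperbolic.

Section Blocks.
Variable R : realType.

Lemma sum_block_mx (I : finType) r1 r2 s1 s2 (A : I -> 'M[R]_(r1, s1)) B C
    (D : I -> 'M[R]_(r2, s2)) :
  \sum_i block_mx (A i) (B i) (C i) (D i) =
  block_mx (\sum_i A i) (\sum_i B i) (\sum_i C i) (\sum_i D i).
Proof.
apply/matrixP => b c; rewrite summxE.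
case: (split_ordP b) => b' ->; case: (split_ordP c) => c' ->;
  rewrite ?block_mxEul ?block_mxEur ?block_mxEdl ?block_mxEdr summxE;
  by apply: eq_bigr => i _;
    rewrite ?block_mxEul ?block_mxEur ?block_mxEdl ?block_mxEdr.
Qed.

Lemma row_sum_scale m s (J : 'M[R]_m) (B : 'M[R]_(m, s)) a :
  \sum_d J a d *: row d B = row a (J *m B).
Proof.
apply/rowP => c; rewrite summxE !mxE; apply: eq_bigr => d _.
by rewrite !mxE.
Qed.

End Blocks.

Section Product.
Variables (R : realType) (N : topologicalType) (n : nat) (A : atlas R N n.*2).
Variables (P h : field A n.*2 n.*2).
Hypothesis ph : paraholomorphic P h.
Let LA := prod_atlas (line_atlas R) A.
Let sA : smooth_manifold A := ph_manifold ph.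
Let sLA : smooth_manifold LA := smooth_manifold_prod sA.

Definition slice_metric (i : index A) (t : R) (q : N) : 'M[R]_n.*2 :=
  cosh (2 * t) *: h i q + sinh (2 * t) *: assoc_metric P h i q.

(** The form [k_t(X, Y) = h_t(X, P Y)], half of the time derivative of [h_t]. *)
Definition slice_form (i : index A) (t : R) (q : N) : 'M[R]_n.*2 :=
  sinh (2 * t) *: h i q + cosh (2 * t) *: assoc_metric P h i q.

Lemma metric_sym i q : dom (A i) q -> (h i q)^T = h i q.
Proof. by case: (ph_metric ph) => _ hs _; exact: hs. Qed.

Lemma P_isometry i q : dom (A i) q -> P i q *m h i q *m (P i q)^T = h i q.
Proof.
move=> dq; apply: bil_inj => x y; rewrite -[RHS](ph_compat ph x y dq).
by rewrite /bil trmx_mul !mulmxA.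
Qed.

(** An isometric involution is self-adjoint. *)
Lemma P_selfadjoint i q : dom (A i) q -> P i q *m h i q = h i q *m (P i q)^T.
Proof.
move=> dq; rewrite -[in RHS](P_isometry dq) -!mulmxA -trmx_mul.
by rewrite (ph_sqr ph dq) trmx1 mulmx1.
Qed.

Lemma assoc_sym i q : dom (A i) q ->
  (assoc_metric P h i q)^T = assoc_metric P h i q.
Proof.
by move=> dq; rewrite /assoc_metric trmx_mul trmxK metric_sym// P_selfadjoint.
Qed.

Lemma P_assoc i q : dom (A i) q -> P i q *m assoc_metric P h i q = h i q.
Proof. by move=> dq; rewrite /assoc_metric mulmxA P_isometry. Qed.

Lemma assoc_P i q : dom (A i) q -> assoc_metric P h i q *m (P i q)^T = h i q.
Proof. by move=> dq; rewrite /assoc_metric -P_selfadjoint// P_isometry. Qed.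

Lemma slice_metric_sym i t q : dom (A i) q ->
  (slice_metric i t q)^T = slice_metric i t q.
Proof.
by move=> dq; rewrite /slice_metric linearD !linearZ /= metric_sym// assoc_sym.
Qed.

Lemma slice_form_sym i t q : dom (A i) q -> (slice_form i t q)^T = slice_form i t q.
Proof.
by move=> dq; rewrite /slice_form linearD !linearZ /= metric_sym// assoc_sym.
Qed.

Lemma P_slice_metric i t q : dom (A i) q ->
  P i q *m slice_metric i t q = slice_form i t q.
Proof.
move=> dq; rewrite /slice_metric mulmxDr -!scalemxAr P_assoc//.
by rewrite P_selfadjoint// addrC.
Qed.

Lemma slice_metric_P i t q : dom (A i) q ->
  slice_metric i t q *m (P i q)^T = slice_form i t q.
Proof.
move=> dq; rewrite /slice_metric mulmxDl -!scalemxAl assoc_P//.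
by rewrite addrC.
Qed.

Lemma P_slice_form i t q : dom (A i) q ->
  P i q *m slice_form i t q = slice_metric i t q.
Proof.
move=> dq; rewrite /slice_form mulmxDr -!scalemxAr P_assoc//.
by rewrite P_selfadjoint// addrC.
Qed.

Lemma metric_ge0 i q x : dom (A i) q -> 0 <= bil (h i q) x x.
Proof.
move=> dq; have [->|x0] := eqVneq x 0; first by rewrite /bil !mul0mx mxE.
by case: (ph_metric ph) => _ _ hp; apply/ltW/hp.
Qed.

Lemma bil_assocE i q x y :
  bil (assoc_metric P h i q) x y = bil (h i q) x (y *m P i q).
Proof. by rewrite /bil /assoc_metric trmx_mul !mulmxA. Qed.

(** Expand [0 <= h(x + Px, x + Px)] and [0 <= h(x - Px, x - Px)]. *)
Lemma assoc_bound i q x : dom (A i) q ->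
  `|bil (assoc_metric P h i q) x x| <= bil (h i q) x x.
Proof.
move=> dq; set y := x *m P i q.
have yy : bil (h i q) y y = bil (h i q) x x := ph_compat ph x x dq.
have yx : bil (h i q) y x = bil (h i q) x y by exact/bil_sym/metric_sym.
have := metric_ge0 (x + y) dq; have := metric_ge0 (x - y) dq.
rewrite !(bilDl, bilDr, bilNl, bilNr) yy yx bil_assocE -/y.
by move=> ? ?; rewrite ler_norml; apply/andP; split; lra.
Qed.

Lemma slice_metric_bound i t q x : dom (A i) q ->
  expR (- (2 * `|t|)) * bil (h i q) x x <= bil (slice_metric i t q) x x <=
  expR (2 * `|t|) * bil (h i q) x x.
Proof.
move=> dq; rewrite /slice_metric bil_metricD !bil_metricZ.
exact/cosh_sinh_bound/assoc_bound.
Qed.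

Lemma smooth_metric : smooth_field h.
Proof. by case: (ph_metric ph) => -[]. Qed.

Lemma smooth_P : smooth_field P.
Proof. by case: (ph_endo ph). Qed.

Lemma chart_img_open (i : index A) : open (chart_img (A i)).
Proof. by case: sA => _ _ /(_ i)[]. Qed.

Lemma smooth_assoc : smooth_field (assoc_metric P h).
Proof.
move=> i; apply: smooth_mxM; first exact: chart_img_open.
  exact: smooth_metric.
by apply: smooth_mx_tr; exact: smooth_P.
Qed.

Lemma chart_img_prod_open (i : index LA) : open (chart_img (LA i)).
Proof. by case: sLA => _ _ /(_ i)[]. Qed.

Lemma smooth_slice_metric (i : index LA) : smooth_mx (chart_img (LA i))
  (fun x => slice_metric i.2 (param (LA i) x).1 (param (LA i) x).2).
Proof.
have oU : open (chart_img (LA i)) by exact: chart_img_prod_open.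
apply: smooth_mxD => //; apply: smooth_mxZ => //.
- exact: smooth_cosh.
- exact: smooth_field_snd smooth_metric.
- exact: smooth_sinh.
- exact: smooth_field_snd smooth_assoc.
Qed.

Lemma smooth_slice_form (i : index LA) : smooth_mx (chart_img (LA i))
  (fun x => slice_form i.2 (param (LA i) x).1 (param (LA i) x).2).
Proof.
have oU : open (chart_img (LA i)) by exact: chart_img_prod_open.
apply: smooth_mxD => //; apply: smooth_mxZ => //.
- exact: smooth_sinh.
- exact: smooth_field_snd smooth_metric.
- exact: smooth_cosh.
- exact: smooth_field_snd smooth_assoc.
Qed.

Section Transformation.
Variables (i j : index A) (q : N).
Hypothesis ov : overlap i j q.

Lemma metric_transform : h i q = jac i j q *m h j q *m (jac i j q)^T.
Proof. by case: (ph_metric ph) => -[_ ht] _ _; exact: ht. Qed.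

Lemma P_transform : P i q *m jac i j q = jac i j q *m P j q.
Proof. by case: (ph_endo ph) => _; exact. Qed.

Lemma assoc_transform : assoc_metric P h i q =
  jac i j q *m assoc_metric P h j q *m (jac i j q)^T.
Proof.
rewrite /assoc_metric metric_transform -!mulmxA -!trmx_mul P_transform.
by rewrite !trmx_mul.
Qed.

Lemma slice_metric_transform t : slice_metric i t q =
  jac i j q *m slice_metric j t q *m (jac i j q)^T.
Proof.
rewrite /slice_metric metric_transform assoc_transform.
by rewrite mulmxDr mulmxDl -!scalemxAr -!scalemxAl.
Qed.

Lemma slice_form_transform t : slice_form i t q =
  jac i j q *m slice_form j t q *m (jac i j q)^T.
Proof.
rewrite /slice_form metric_transform assoc_transform.
by rewrite mulmxDr mulmxDl -!scalemxAr -!scalemxAl.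
Qed.

End Transformation.

Let g := prod_metric h (assoc_metric P h).

Lemma prod_metricE i p : g i p = block_mx 1%:M 0 0 (slice_metric i.2 p.1 p.2).
Proof. by []. Qed.

Lemma overlap_snd (i j : index LA) p : overlap i j p -> overlap i.2 j.2 p.2.
Proof. by rewrite overlap_prod => -[]. Qed.

Lemma bil_prod (G : 'M[R]_n.*2) (x y : 'rV[R]_(1 + n.*2)) :
  bil (block_mx 1%:M 0 0 G) x y =
  x 0 (lshift _ 0) * y 0 (lshift _ 0) + bil G (rsubmx x) (rsubmx y).
Proof. by rewrite -{1}[x]hsubmxK -{1}[y]hsubmxK bil_block !mxE. Qed.

(** Positivity holds because [h_t] dominates a positive multiple of [h]. *)
Lemma riemannian_prod : riemannian g.
Proof.
split.
- split=> [i|i j p ov].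
    by apply: smooth_mx_block; [exact: smooth_mx_cst..|exact: smooth_slice_metric].
  rewrite !prod_metricE (jac_prod sA ov) (slice_metric_transform (overlap_snd ov)).
  rewrite tr_block_mx !mulmx_block.
  by rewrite !(mulmx0, mul0mx, addr0, add0r, mulmx1, trmx0, trmx1, mul1mx).
- move=> i p [_ dp]; rewrite prod_metricE tr_block_mx !trmx0 trmx1.
  by rewrite slice_metric_sym.
- move=> i p x [_ dp] x0; rewrite prod_metricE bil_prod -expr2.
  have [/andP[lb _]] := (slice_metric_bound p.1 (rsubmx x) dp).
  have hge := metric_ge0 (rsubmx x) dp.
  have e0 : 0 < expR (- (2 * `|p.1|)) by exact: expR_gt0.
  have [y0|y0] := eqVneq (rsubmx x) 0.
    rewrite ltr_pwDl//; last by apply: le_trans lb; rewrite mulr_ge0// ltW.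
    rewrite exprn_even_gt0//=; apply: contra_neq x0 => x00.
    rewrite -[x]hsubmxK y0; have -> : lsubmx x = 0; last by rewrite row_mx0.
    by apply/rowP => b; rewrite !ord1 !mxE.
  rewrite ltr_pwDr ?sqr_ge0//; apply: lt_le_trans lb; rewrite mulr_gt0//.
  by case: (ph_metric ph) => _ _; exact.
Qed.

Lemma mul_prod_phi (z : 'rV[R]_(1 + n.*2)) (i : index LA) p :
  z *m prod_phi P i p = row_mx 0 (rsubmx z *m P i.2 p.2).
Proof.
by rewrite -{1}[z]hsubmxK mul_row_block !(mulmx0, mul0mx, addr0, add0r).
Qed.

Lemma mul_prod_eta (z : 'rV[R]_(1 + n.*2)) (i : index LA) p :
  z *m prod_eta A i p = lsubmx z.
Proof. by rewrite -{1}[z]hsubmxK mul_row_col mulmx0 mulmx1 addr0. Qed.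

Lemma almost_paracontact_prod :
  almost_paracontact (prod_phi P) (prod_xi A) (prod_eta A) g.
Proof.
split.
- exact: sLA.
- split=> [i|i j p ov].
    apply: smooth_mx_block; [exact: smooth_mx_cst..|].
    exact: smooth_field_snd smooth_P.
  rewrite (jac_prod sA ov) /prod_phi !mulmx_block.
  by rewrite !(mulmx0, mul0mx, addr0, add0r) (P_transform (overlap_snd ov)).
- split=> [i|i j p ov]; first exact: smooth_mx_cst.
  rewrite (jac_prod sA ov) /prod_xi mul_row_block.
  by rewrite !(mulmx0, mul0mx, addr0, add0r, mulmx1).
- split=> [i|i j p ov]; first exact: smooth_mx_cst.
  rewrite (jac_prod sA ov) /prod_eta mul_block_col.
  by rewrite !(mulmx0, mul0mx, addr0, add0r, mulmx1).
- move=> i p [_ dp]; rewrite /prod_phi /prod_eta /prod_xi mulmx_block mul_col_row.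
  rewrite !(mulmx0, mul0mx, addr0, add0r, mulmx1) (ph_sqr ph dp).
  rewrite scalar_mx_block opp_block_mx add_block_mx.
  by rewrite !(oppr0, addr0) subrr.
- move=> i p [_ dp]; rewrite /prod_eta /prod_xi mul_row_col.
  by rewrite mulmx1 mulmx0 addr0.
- move=> i p [_ dp]; rewrite rank_horizontal_eigenspace.
  by apply: rank_eigenspace_involution;
    [rewrite expr1n|exact: (ph_sqr ph dp)|exact: (ph_tr ph dp)].
- move=> i p [_ dp]; rewrite rank_horizontal_eigenspace.
  by apply: rank_eigenspace_involution;
    [rewrite sqrrN expr1n|exact: (ph_sqr ph dp)|exact: (ph_tr ph dp)].
- exact: riemannian_prod.
- move=> i p x [_ dp]; rewrite mul_prod_eta prod_metricE bil_prod.
  by rewrite row_mxKr row_mxEl !mxE eqxx mulr1 /bil trmx0 mulmx0 mxE addr0.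
- move=> i p x y [_ dp]; rewrite prod_metricE !mul_prod_eta !mul_prod_phi.
  rewrite !bil_prod !row_mxKr !row_mxEl !mxE mul0r add0r addrAC subrr add0r.
  have PSP : P i.2 p.2 *m slice_metric i.2 p.1 p.2 *m (P i.2 p.2)^T =
    slice_metric i.2 p.1 p.2.
    by rewrite -mulmxA slice_metric_P// P_slice_form.
  by rewrite /bil -[in RHS]PSP trmx_mul !mulmxA.
Qed.

End Product.

(** * The Levi-Civita connection *)

Lemma nabla_endo_delta (R : realType) (M : topologicalType) (m : nat)
    (A : atlas R M m) (D : christoffel A) (T : field A m m) i p a :
  nabla_endo D T i p (delta_mx 0 a) =
  pd i a (T i) p + T i p *m D i p a - D i p a *m T i p.
Proof.
rewrite /nabla_endo (bigD1 a)//= big1 ?addr0 => [|b ba].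
  by rewrite mxE !eqxx scale1r.
by rewrite mxE (negPf ba) andbF scale0r.
Qed.

Section LeviCivita.
Variables (R : realType) (N : topologicalType) (n : nat) (A : atlas R N n.*2).
Variables (P h : field A n.*2 n.*2).
Hypothesis ph : paraholomorphic P h.
Let LA := prod_atlas (line_atlas R) A.
Let sA : smooth_manifold A := ph_manifold ph.
Let sLA : smooth_manifold LA := smooth_manifold_prod sA.
Let g := prod_metric h (assoc_metric P h).
Local Notation slice_metric := (slice_metric P h).
Local Notation slice_form := (slice_form P h).

(** In matrix form: differentiating along time maps [X] to [P X]; differentiating
    along the a-th direction [e] of [N] maps [d/dt] to [P e] and [Y] to
    [D_e Y - k_t(e, Y) d/dt]. *)
Definition prod_christoffel (D : christoffel A) : christoffel LA :=
  fun i p a => match fintype.split a with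
  | inl _ => block_mx 0 0 0 (P i.2 p.2)
  | inr a' => block_mx 0 (row a' (P i.2 p.2))
      (- (row a' (slice_form i.2 p.1 p.2))^T) (D i.2 p.2 a')
  end.

Variable D : christoffel A.
Hypothesis hD : levi_civita h D.
Hypothesis hP : forall i p x, dom (A i) p -> nabla_endo D P i p x = 0.

Lemma prod_christoffel_time i p a : prod_christoffel D i p (lshift _ a) =
  block_mx 0 0 0 (P i.2 p.2).
Proof. by rewrite /prod_christoffel (unsplitK (inl a)). Qed.

Lemma prod_christoffel_space i p a : prod_christoffel D i p (rshift 1 a) =
  block_mx 0 (row a (P i.2 p.2))
      (- (row a (slice_form i.2 p.1 p.2))^T) (D i.2 p.2 a).
Proof. by rewrite /prod_christoffel (unsplitK (inr a)). Qed.

Lemma atlas_is_chart (i : index A) : is_chart (A i).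
Proof. by case: sA. Qed.

(** The equation [D P = 0] solved for the partial derivatives of [P]. *)
Lemma pd_P i a q : dom (A i) q ->
  pd i a (P i) q = D i q a *m P i q - P i q *m D i q a.
Proof.
move=> dq; have := hP (delta_mx 0 a) dq; rewrite nabla_endo_delta.
by move/eqP; rewrite -addrA addr_eq0 opprD opprK addrC => /eqP.
Qed.

Lemma pd_h i a q : dom (A i) q ->
  pd i a (h i) q = D i q a *m h i q + h i q *m (D i q a)^T.
Proof. by case: hD => _ _; exact. Qed.

(** The associated metric is [D]-parallel because [h] and [P] are. *)
Lemma pd_assoc i a q : dom (A i) q -> pd i a (assoc_metric P h i) q =
  D i q a *m assoc_metric P h i q + assoc_metric P h i q *m (D i q a)^T.
Proof.
move=> dq; rewrite /assoc_metric.
rewrite (pdM _ (atlas_is_chart i) dq (T := fun q => (P i q)^T)).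
- rewrite pd_tr pd_h// pd_P// linearB /= !trmx_mul mulmxBr mulmxDl !mulmxA.
  by rewrite -!addrA; congr (_ + _); rewrite addrC subrK.
- exact: smooth_chart_differentiable (smooth_metric ph) dq.
- move=> b c; under eq_fun do rewrite mxE.
  exact: (smooth_chart_differentiable (smooth_P ph) dq).
Qed.

(** Each [h_t] is a combination of [D]-parallel forms with coefficients that are
    constant on the slice, so [D] is its Levi-Civita connection. *)
Lemma pd_slice_metric i a t q : dom (A i) q ->
  pd i a (slice_metric i t) q =
  D i q a *m slice_metric i t q + slice_metric i t q *m (D i q a)^T.
Proof.
move=> dq; have dh := smooth_chart_differentiable (smooth_metric ph) dq.
have da := smooth_chart_differentiable (smooth_assoc ph) dq.
have dZ k (T : N -> 'M[R]_n.*2) : 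
    chart_differentiable i T q -> chart_differentiable i (fun q => k *: T q) q.
  move=> dT b c; under eq_fun do rewrite mxE.
  by apply: differentiableM => //; exact: dT.
rewrite /slice_metric pdD ?pdZ//; [|exact: dZ..].
rewrite pd_h// pd_assoc// mulmxDr mulmxDl -!scalemxAr -!scalemxAl.
by rewrite !scalerDr addrACA.
Qed.

(** Blockwise, the transformation law is that of [P] for the time direction and
    for the upper right block, that of [k_t] for the lower left block and that of
    [D] for the lower right block. *)
Lemma connection_prod : connection (prod_christoffel D).
Proof.
have [[sD tD] _ _] := hD; split=> [a i|i j p a ov].
  have oU := @chart_img_prod_open _ _ _ _ _ _ ph i.
  suff : smooth_mx (chart_img (LA i))
    (fun x => prod_christoffel D i (param (LA i) x) a) by [].
  case: (split_ordP a) => a' ->.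
    under [X in smooth_mx _ X]eq_fun do rewrite prod_christoffel_time.
    apply: smooth_mx_block; [exact: smooth_mx_cst..|].
    exact: smooth_field_snd (smooth_P ph).
  under [X in smooth_mx _ X]eq_fun do rewrite prod_christoffel_space.
  apply: smooth_mx_block.
  - exact: smooth_mx_cst.
  - by apply: smooth_mx_row; exact: smooth_field_snd (smooth_P ph).
  - rewrite (_ : (fun x => _) = (fun x => -1 *: (row a' (slice_form i.2
        (param (LA i) x).1 (param (LA i) x).2))^T)); last first.
      by apply/funext => x; rewrite scaleN1r.
    apply: smooth_mxZ => //; first exact: smooth_on_cst.
    by apply: smooth_mx_tr; apply: smooth_mx_row; exact: smooth_slice_form.
  - exact: (@smooth_field_snd _ _ _ _ _ _ (fun i p => D i p a') i (sD a')).
have ov2 := overlap_snd ov; have dp : dom (A i.2) p.2 by case: ov2.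
have dLp : dom (LA i) p by [].
have oW : open (overlap (A := LA) i j).
  by case: sLA => _ _ cLA _ _; apply: openI; [case: (cLA i)|case: (cLA j)].
have chartLA : is_chart (LA i) by case: sLA.
rewrite (pd_eq a chartLA dLp oW ov (T := fun p => block_mx 1%:M 0 0
  (jac i.2 j.2 p.2))); last by move=> q; rewrite inE; exact: jac_prod.
rewrite pd_block !pd_cst (jac_prod sA ov) big_split_ord /= big_ord1.
case: (split_ordP a) => a' ->.
  rewrite prod_christoffel_time big1 => [|d _]; last first.
    by rewrite block_mxEur mxE scale0r.
  rewrite block_mxEul !ord1 mxE eqxx scale1r prod_christoffel_time addr0.
  rewrite pd_time//= (_ : \matrix_(b, c) _ = 0); last first.
    by apply/matrixP => b c; rewrite !mxE derive1_cst.
  rewrite !mulmx_block !(mulmx0, mul0mx, addr0, add0r) (P_transform ph ov2).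
  by rewrite add_block_mx !add0r.
rewrite prod_christoffel_space block_mxEdl mxE scale0r add0r pd_space.
under eq_bigr => d _.
  rewrite block_mxEdr prod_christoffel_space mulmx_block.
  rewrite !(mulmx0, mul0mx, addr0, add0r, mul1mx) scale_block_mx scaler0.
  over.
rewrite sum_block_mx !mulmx_block add_block_mx big1//.
rewrite !(mulmx0, mul0mx, addr0, add0r, mul1mx, mulmx1); congr block_mx.
- by rewrite row_sum_scale -(P_transform ph ov2) row_mul.
- transitivity (- (jac i.2 j.2 p.2 *m
      (row a' (jac i.2 j.2 p.2 *m slice_form j.2 p.1 p.2))^T)).
    by rewrite (slice_form_transform ph ov2) [in LHS]row_mul trmx_mul trmxK.
  rewrite -row_sum_scale linear_sum /= mulmx_sumr -sumrN.
  by apply: eq_bigr => d _; rewrite linearZ /= -scalemxAr mulmxN scalerN.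
- exact: tD.
Qed.

Lemma derive1_cosh_sinh m (H S : 'M[R]_m) b c t :
  derive1 (fun t => (cosh (2 * t) *: H + sinh (2 * t) *: S) b c) t =
  2 * (sinh (2 * t) *: H + cosh (2 * t) *: S) b c.
Proof.
have dc : is_derive t 1 (fun t : R => cosh (2 * t)) (2 * sinh (2 * t)).
  apply: DeriveDef; first exact: derivable_cosh2.
  by rewrite -derive1E derive1_cosh2.
have ds : is_derive t 1 (fun t : R => sinh (2 * t)) (2 * cosh (2 * t)).
  apply: DeriveDef; first exact: derivable_sinh2.
  by rewrite -derive1E derive1_sinh2.
rewrite derive1E !mxE; under eq_fun do rewrite !mxE.
by rewrite derive_val /GRing.scale/=; ring.
Qed.

Lemma row_entry m k (B : 'M[R]_(m, k)) a b c : row a B b c = B a c.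
Proof. exact: mxE. Qed.

Lemma opp_row_tr_entry m k (B : 'M[R]_(m, k)) a b c : (- (row a B)^T) b c = - B a b.
Proof. by rewrite !mxE. Qed.

Lemma levi_civita_prod : levi_civita g (prod_christoffel D).
Proof.
have [_ torD _] := hD.
split; first exact: connection_prod.
- move=> i p a b c [_ dp].
  case: (split_ordP a) => a' ->; case: (split_ordP b) => b' ->;
    rewrite ?prod_christoffel_time ?prod_christoffel_space;
    case: (split_ordP c) => c' ->; rewrite ?block_mxEul ?block_mxEur
      ?block_mxEdl ?block_mxEdr ?row_entry ?opp_row_tr_entry//.
  1-4: by rewrite [LHS]mxE [RHS]mxE.
  by have /matrixP/(_ b' a') := slice_form_sym ph p.1 dp; rewrite mxE => ->.
  exact: torD.
- move=> i p a [_ dp].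
  have -> : g i = fun p => block_mx 1%:M 0 0 (slice_metric i.2 p.1 p.2) by [].
  rewrite pd_block !pd_cst.
  case: (split_ordP a) => a' ->.
    rewrite ord1 pd_time// prod_christoffel_time tr_block_mx !mulmx_block.
    rewrite !(mulmx0, mul0mx, addr0, add0r, trmx0) add_block_mx !addr0.
    congr block_mx; rewrite (P_slice_metric ph)// (slice_metric_P ph)//.
    apply/matrixP => b c; rewrite [LHS]mxE [RHS]mxE.
    transitivity (2 * slice_form i.2 p.1 p.2 b c); last by rewrite mulr_natl mulr2n.
    exact: (derive1_cosh_sinh (h i.2 p.2) (assoc_metric P h i.2 p.2) b c p.1).
  rewrite pd_space prod_christoffel_space tr_block_mx !mulmx_block.
  rewrite !(mulmx0, mul0mx, addr0, add0r, trmx0, mulmx1, mul1mx) add_block_mx.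
  rewrite !linearN /= trmxK pd_slice_metric// addr0.
  rewrite -(P_slice_metric ph)// row_mul.
  by rewrite subrr trmx_mul (slice_metric_sym ph)// addNr.
Qed.

(** The lower right block vanishes by [D P = 0], and [P^2 = 1] turns [P e] into [e]
    in the upper right block. *)
Lemma nabla_prod_phi i p x : dom (A i.2) p.2 ->
  nabla_endo (prod_christoffel D) (prod_phi P) i p x =
  block_mx 0 (- rsubmx x)
    (- (P i.2 p.2 *m (slice_form i.2 p.1 p.2) *m (rsubmx x)^T)) 0.
Proof.
move=> dp; rewrite /nabla_endo big_split_ord /= big_ord1.
rewrite prod_christoffel_time pd_time//= (_ : \matrix_(b, c) _ = 0); last first.
  apply/matrixP => b c; rewrite [LHS]mxE [RHS]mxE.
  exact: (derive1_cst (prod_phi P i p b c) p.1).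
rewrite add0r /prod_phi subrr scaler0 add0r.
under eq_bigr => a _.
  rewrite prod_christoffel_space pd_space /= pd_block !pd_cst !mulmx_block.
  rewrite !(mulmx0, mul0mx, addr0, add0r) opp_block_mx !add_block_mx.
  rewrite !(oppr0, addr0, add0r) -row_mul (ph_sqr ph dp) mulmxN.
  rewrite (pd_P _ dp) subrK subrr scale_block_mx !scaler0.
  over.
have xrow k (B : 'M[R]_(n.*2, k)) :
    \sum_a x 0 (rshift 1 a) *: row a B = rsubmx x *m B.
  by rewrite mulmx_sum_row; apply: eq_bigr => a _; rewrite mxE.
rewrite sum_block_mx; congr block_mx; [exact: big1| | |exact: big1].
  by rewrite -[X in - X]mulmx1 -xrow -sumrN; apply: eq_bigr => a _; rewrite scalerN.
rewrite -[slice_form _ _ _ in RHS](slice_form_sym ph p.1 dp) -mulmxA.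
rewrite -trmx_mul -xrow.
rewrite linear_sum mulmx_sumr -sumrN; apply: eq_bigr => a _.
by rewrite scalerN /= [(_ *: _)^T]linearZ /= -scalemxAr.

Qed.

(** The only surviving value of [F] on horizontal vectors is
    [F(X, Y, xi) = - k_t(X, P Y) = - h_t(X, Y)]. *)
Lemma para_sasaki_like_prod :
  para_sasaki_like (prod_phi P) (prod_xi A) (prod_eta A) g.
Proof.
split; first exact: almost_paracontact_prod.
exists (prod_christoffel D); first exact: levi_civita_prod.
move=> i p x y z [_ dp]; rewrite !mul_prod_eta => x0 y0 z0.
rewrite /Ftensor !nabla_prod_phi//.
have -> : g i p = block_mx 1%:M 0 0 (slice_metric i.2 p.1 p.2) by [].
rewrite /prod_xi !bil_prod.
rewrite -[x]hsubmxK -[y]hsubmxK -[z]hsubmxK x0 y0 z0.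
rewrite !mul_row_block.
rewrite !(mulmx0, mul0mx, addr0, add0r, mul1mx, row_mxKr, row_mxEl, oppr0).
have mx0 : (0 : 'M[R]_1) 0 0 = 0 by rewrite mxE.
have mx1 : (1%:M : 'M[R]_1) 0 0 = 1 by rewrite mxE eqxx.
have bil0 (G : 'M[R]_n.*2) v : bil G 0 v = 0 by rewrite /bil !mul0mx mxE.
rewrite !bil0 mx0 mx1 !mulr0 !add0r mulr1 addr0; split=> //.
rewrite (P_slice_form ph)// mulmxN mulmxA (bil_sym _ _ (slice_metric_sym ph _ dp)).
by rewrite [LHS]mxE.
Qed.

End LeviCivita.

(** * Curves in the product *)

Section Curves.
Variables (R : realType) (N : topologicalType) (m : nat) (A : atlas R N m).
Hypothesis sA : smooth_manifold A.
Let LA := prod_atlas (line_atlas R) A.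

Lemma derivable_row_mx m1 m2 (f : R -> 'rV[R]_m1) (v : R -> 'rV[R]_m2) s :
  derivable (fun s => row_mx (f s) (v s)) s 1 <->
  derivable f s 1 /\ derivable v s 1.
Proof.
rewrite !derivable_mxP; split=> [d|[df dv] a b].
  split=> a b.
    by have := d a (lshift m2 b); under eq_fun do rewrite row_mxEl.
  by have := d a (rshift m1 b); under eq_fun do rewrite row_mxEr.
case: (split_ordP b) => b' ->.
  by under eq_fun do rewrite row_mxEl; exact: df.
by under eq_fun do rewrite row_mxEr; exact: dv.
Qed.

Lemma derive1_row_mx m1 m2 (f : R -> 'rV[R]_m1) (v : R -> 'rV[R]_m2) s :
  derivable f s 1 -> derivable v s 1 ->
  derive1 (fun s => row_mx (f s) (v s)) s = row_mx (derive1 f s) (derive1 v s).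
Proof.
move=> df dv; rewrite !derive1E derive_mx; last exact/derivable_row_mx.
rewrite (derive_mx df) (derive_mx dv); apply/matrixP => a b; rewrite mxE.
case: (split_ordP b) => b' ->; rewrite ?row_mxEl ?row_mxEr mxE;
  by under eq_fun do rewrite ?row_mxEl ?row_mxEr.
Qed.

Lemma derivable_scalar_mx11 (f : R -> R) s :
  derivable (fun s => (f s)%:M : 'rV[R]_1) s 1 <-> derivable f s 1.
Proof.
have E : (fun x => ((f x)%:M : 'rV[R]_1) 0 0) = f.
  by apply/funext => x; rewrite mxE eqxx.
rewrite derivable_mxP; split=> [/(_ 0 0)|df a b]; first by rewrite E.
by rewrite !ord1 E.
Qed.

Lemma derive1_scalar_mx11 (f : R -> R) s : derivable f s 1 ->
  derive1 (fun s => (f s)%:M : 'rV[R]_1) s = (derive1 f s)%:M.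
Proof.
move=> df; have E : (fun x => ((f x)%:M : 'rV[R]_1) 0 0) = f.
  by apply/funext => x; rewrite mxE eqxx.
rewrite !derive1E derive_mx; last exact/derivable_scalar_mx11.
by apply/matrixP => a b; rewrite !ord1 mxE [RHS]mxE eqxx mulr1n E.
Qed.

Implicit Types (gamma : R -> R * N) (i : index LA).

Lemma derivable_coord_prod i gamma s :
  derivable (coord (LA i) \o gamma) s 1 <->
  derivable (fst \o gamma) s 1 /\ derivable (coord (A i.2) \o snd \o gamma) s 1.
Proof. by rewrite derivable_row_mx derivable_scalar_mx11. Qed.

Lemma derive1_coord_prod i gamma s :
  derivable (coord (LA i) \o gamma) s 1 ->
  derive1 (coord (LA i) \o gamma) s =
  row_mx (derive1 (fst \o gamma) s)%:M
    (derive1 (coord (A i.2) \o (snd \o gamma)) s).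
Proof.
move=> /derivable_coord_prod[df dv]; rewrite derive1_row_mx//.
  by rewrite derive1_scalar_mx11.
exact/derivable_scalar_mx11.
Qed.

Lemma near_chart_dom (beta : R -> N) (i : index A) s : continuous beta ->
  dom (A i) (beta s) -> \forall s' \near s, dom (A i) (beta s').
Proof.
move=> cb ds; case: sA => _ _ /(_ i)[od _ _ _ _] _ _.
exact: (cb s _ (open_nbhs_nbhs (conj od ds))).
Qed.

Lemma continuous_snd_comp gamma : continuous gamma -> continuous (snd \o gamma).
Proof. by move=> cg s; apply: continuous_comp; [exact: cg|exact: cvg_snd]. Qed.

(** Continuity of the derivative is local, and near each time a single chart
    serves for the whole curve. *)
Lemma C1_curve_fst gamma : C1_curve LA gamma ->
  (forall s, derivable (fst \o gamma) s 1) /\ continuous (derive1 (fst \o gamma)).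
Proof.
move=> [cg dg]; case: (sA) => _ _ _ dA _.
have df s : derivable (fst \o gamma) s 1.
  have [|+ _] := dg s (tt, chart_at A (gamma s).2); first by split=> //; exact: dA.
  by move=> /derivable_coord_prod[].
split; first exact: df.
move=> s; pose i : index LA := (tt, chart_at A (gamma s).2).
have ds : dom (LA i) (gamma s) by split=> //; exact: dA.
have [_ cs] := dg s i ds.
have := near_chart_dom (i := i.2) (continuous_snd_comp cg) ds.2.
move=> nds; apply: (near_eq_continuous
  (f := fun s => (derive1 (coord (LA i) \o gamma) s) 0 (lshift m 0))).
  apply: filterS nds => s' ds'.
  have [ds1 _] := dg s' i (conj I ds').
  by rewrite derive1_coord_prod// row_mxEl mxE eqxx.
exact: (@continuous_comp _ _ _ _ (fun M : 'rV[R]_(1 + m) => M 0 (lshift m 0)) s cs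
  (@coord_continuous _ _ _ _ _ _)).
Qed.

Lemma C1_curve_snd gamma : C1_curve LA gamma -> C1_curve A (snd \o gamma).
Proof.
move=> [cg dg]; split; first exact: continuous_snd_comp.
move=> s i ds; pose j : index LA := (tt, i).
have [ds1 cs] := dg s j (conj I ds).
split; first by case/derivable_coord_prod : ds1.
have nds := near_chart_dom (continuous_snd_comp cg) ds.
apply: (near_eq_continuous
  (f := fun s => rsubmx (derive1 (coord (LA j) \o gamma) s))).
  apply: filterS nds => s' ds'.
  have [ds1' _] := dg s' j (conj I ds').
  by rewrite derive1_coord_prod// row_mxKr.
exact: (@continuous_comp _ _ _ _ (rsubmx : 'rV[R]_(1 + m) -> _) s cs
  (@continuous_rsubmx _ _ _ _ _)).
Qed.

Lemma C1_curve_pair (alpha : R -> R) (beta : R -> N) :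
  (forall s, derivable alpha s 1) -> continuous (derive1 alpha) ->
  C1_curve A beta -> C1_curve LA (fun s => (alpha s, beta s)).
Proof.
move=> da ca [cb db].
have cal : continuous alpha.
  by move=> s; apply: differentiable_continuous; exact/derivable1_diffP.
split=> [s|s i [_ ds]]; first exact: (cvg_pair (cal s) (cb s)).
have nds := near_chart_dom cb ds.
pose gamma s := (alpha s, beta s).
have dgam s' : dom (A i.2) (beta s') -> derivable (coord (LA i) \o gamma) s' 1.
  move=> ds'; apply/(derivable_coord_prod i gamma s'); split; first exact: da.
  exact: (db s' i.2 ds').1.
split; first exact: dgam.
have [db1 cb1] := db s i.2 ds.
apply: (near_eq_continuous (f := fun s => row_mx (derive1 alpha s)%:M
   (derive1 (coord (A i.2) \o beta) s))).
  apply: filterS nds => s' ds'; symmetry.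
  exact: (@derive1_coord_prod i gamma s' (dgam s' ds')).
apply: continuous_row_mx => //.
apply: (@continuous_comp _ _ _ (derive1 alpha) (fun t : R => t%:M : 'rV[R]_1)).
  exact: ca.
exact: continuous_scalar_mx11.
Qed.

Lemma C1_curve_cst (q : N) : C1_curve A (fun=> q).
Proof.
split; first exact: cst_continuous.
move=> s i _; have -> : coord (A i) \o (fun=> q) = cst (coord (A i) q) by [].
split; first exact: derivable_cst.
have -> : derive1 (cst (coord (A i) q) : R -> _) = cst 0.
  by apply/funext => x; rewrite derive1_cst.
exact: cst_continuous.
Qed.

End Curves.

(** * Lengths, paths and completeness *)

Section IntegralMonotone.
Local Open Scope ereal_scope.
Import HBNNSimple.

(** Used for speeds, which are computed in charts that jump along the curve.  The
    integral of a nonnegative function is the supremum of the integrals of the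
    simple functions below it, and when [k] is below [f1] on [D] then [k / c] is
    below [f2] there. *)
Lemma le_integral_scale d (T : measurableType d) (R : realType)
    (mu : {measure set T -> \bar R}) (D E : set T) (f1 f2 : T -> \bar R) (c : R) :
  (0 < c)%R -> D `<=` E -> (forall x, D x -> 0 <= f1 x) ->
  (forall x, E x -> 0 <= f2 x) -> (forall x, D x -> f1 x <= c%:E * f2 x) ->
  \int[mu]_(x in D) f1 x <= c%:E * \int[mu]_(x in E) f2 x.
Proof.
move=> c0 DE f10 f20 f12; rewrite (ge0_integralE _ f10).
have c'0 : (0 <= c^-1)%R by rewrite invr_ge0 ltW.
apply: ge_ereal_sup => _ /= [k kf1 <-].
have -> : sintegral mu k = c%:E * sintegral mu (scale_nnsfun k c'0).
  rewrite -sintegralrM; apply: eq_sintegral => x /=.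
  by rewrite mulrA divff ?mul1r// gt_eqF.
rewrite lee_pmul2l ?lte_fin//; rewrite (ge0_integralE _ f20).
apply: ereal_sup_ubound; exists (scale_nnsfun k c'0) => //= x.
have := kf1 x; rewrite !patchE.
have [xD kx|xD kx] := boolP (x \in D).
  rewrite ifT; last by rewrite inE; apply: DE; rewrite -inE.
  rewrite EFinM lee_pdivrMl//; apply: le_trans kx _; apply: f12.
  by rewrite -inE.
apply: (@le_trans _ _ 0).
  by rewrite lee_fin mulr_ge0_le0// -lee_fin.
by case: ifPn => // /[!inE]; exact: f20.
Qed.

End IntegralMonotone.

Section Lengths.
Variable R : realType.

Lemma sqrt_expR_double (u x : R) :
  Num.sqrt (expR (2 * u) * x) = expR u * Num.sqrt x.
Proof.
rewrite mulr_natl mulr2n expRD -expr2 sqrtrM ?sqr_ge0// sqrtr_sqr.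
by rewrite ger0_norm// expR_ge0.
Qed.

Lemma variation_le_integral_derive (f : R -> R) (a b : R) : a <= b ->
  (forall s, derivable f s 1) -> continuous (derive1 f) ->
  ((`|f b - f a|)%:E <=
   \int[lebesgue_measure]_(s in `[a, b]) `|derive1 f s|%:E)%E.
Proof.
rewrite le_eqVlt => /predU1P[<-|ab] df cf.
  by rewrite subrr normr0; apply: integral_ge0 => s _; rewrite lee_fin.
have FTC : (\int[lebesgue_measure]_(s in `[a, b]) (derive1 f s)%:E =
   (f b)%:E - (f a)%:E)%E.
  apply: (continuous_FTC2 ab); last by [].
    exact: continuous_subspaceT.
  have cfx x : {for x, continuous f}.
    by apply: differentiable_continuous; exact/derivable1_diffP.
  split=> [x _||].
  - exact: df.
  - exact: cvg_at_right_filter (cfx a).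
  - exact: cvg_at_left_filter (cfx b).
have -> : (`|f b - f a|%:E = `| (f b)%:E - (f a)%:E |)%E by [].
rewrite -FTC.
have := @le_abse_integral _ _ R lebesgue_measure `[a, b]%classic
  (EFin \o derive1 f) (measurable_itv _) .
apply.
apply/measurable_EFinP; apply: measurable_funTS.
exact: continuous_measurable_fun.
Qed.

Section Paths.
Variables (M : topologicalType) (m : nat) (A : atlas R M m) (g : field A m m).

Lemma speed_ge0 gamma s : 0 <= speed g gamma s.
Proof. exact: sqrtr_ge0. Qed.

Lemma curve_length_ge0 gamma a b : (0 <= curve_length g gamma a b)%E.
Proof. by apply: integral_ge0 => s _; rewrite lee_fin speed_ge0. Qed.

Lemma path_length_ge0 p q L : path_length g p q L -> (0 <= L)%E.
Proof.
elim=> [//|gamma a b q' L' _ _ _ L0]; apply: adde_ge0 => //.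
exact: curve_length_ge0.
Qed.

Lemma riem_dist_lt_path p q (e : R) : (riem_dist g p q < e%:E)%E ->
  exists2 L, path_length g p q L & (L < e%:E)%E.
Proof. by move=> /ereal_inf_lt[L /= pL Le]; exists L. Qed.

Lemma riem_dist_le_path p q L : path_length g p q L -> (riem_dist g p q <= L)%E.
Proof. by move=> pL; exact: ereal_inf_lbound. Qed.

End Paths.
End Lengths.

Section Completeness.
Variables (R : realType) (N : topologicalType) (n : nat) (A : atlas R N n.*2).
Variables (P h : field A n.*2 n.*2).
Hypothesis ph : paraholomorphic P h.
Let LA := prod_atlas (line_atlas R) A.
Let sA : smooth_manifold A := ph_manifold ph.
Let g : field LA (1 + n.*2) (1 + n.*2) := prod_metric h (assoc_metric P h).

Lemma dom_chart_at q : dom (A (chart_at A q)) q.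
Proof. by case: sA => _ _ _ + _; exact. Qed.

Lemma speed_prodE gamma s : C1_curve LA gamma ->
  let i := chart_at A (gamma s).2 in
  let v := derive1 (coord (A i) \o (snd \o gamma)) s in
  speed g gamma s = Num.sqrt (derive1 (fst \o gamma) s ^+ 2 +
     bil (slice_metric P h i (gamma s).1 (gamma s).2) v v).
Proof.
move=> [_ dg] i v.
have ds := dom_chart_at (gamma s).2.
rewrite /speed -/g.
have [d1 _] := dg s (tt, i) (conj I ds).
have := derive1_coord_prod d1; rewrite -/v => E.
rewrite (_ : chart_at LA (gamma s) = (tt, i)) // E.
rewrite /g /prod_metric -/(slice_metric P h _ _ _) bil_block.
by rewrite !mxE eqxx mulr1n -expr2.
Qed.

Lemma speed_time_le gamma s : C1_curve LA gamma ->
  `|derive1 (fst \o gamma) s| <= speed g gamma s.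
Proof.
move=> cg; rewrite speed_prodE// -sqrtr_sqr; apply: ler_wsqrtr.
rewrite lerDl.
have /andP[+ _] := slice_metric_bound ph (gamma s).1
   (derive1 (coord (A (chart_at A (gamma s).2)) \o (snd \o gamma)) s)
   (dom_chart_at (gamma s).2).
apply: le_trans; rewrite mulr_ge0 ?expR_ge0//.
exact: (metric_ge0 ph _ (dom_chart_at _)).
Qed.

Lemma speed_space_le gamma s : C1_curve LA gamma ->
  speed h (snd \o gamma) s <= expR `|(gamma s).1| * speed g gamma s.
Proof.
move=> cg; rewrite speed_prodE// -sqrt_expR_double; apply: ler_wsqrtr.
have dq := dom_chart_at (gamma s).2.
have /andP[+ _] := slice_metric_bound ph (gamma s).1
   (derive1 (coord (A (chart_at A (gamma s).2)) \o (snd \o gamma)) s) dq.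
rewrite expRN ler_pdivrMl ?expR_gt0// => le1.
apply: le_trans le1 _; rewrite ler_wpM2l ?expR_ge0// lerDr.
exact: sqr_ge0.
Qed.

Lemma speed_slice_le (t : R) beta s : C1_curve A beta ->
  speed g (fun s => (t, beta s)) s <= expR `|t| * speed h beta s.
Proof.
move=> cb; have cg : C1_curve LA (fun s => (t, beta s)).
  apply: (C1_curve_pair sA (alpha := cst t)) => //.
  rewrite (_ : derive1 _ = cst 0); first exact: cst_continuous.
  by apply/funext => x; rewrite derive1_cst.
rewrite speed_prodE// -sqrt_expR_double; apply: ler_wsqrtr.
rewrite (_ : fst \o _ = cst t)// derive1_cst expr0n /= add0r.
by have /andP[] := slice_metric_bound ph t
   (derive1 (coord (A (chart_at A (beta s))) \o beta) s) (dom_chart_at (beta s)).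
Qed.

Lemma time_variation_le gamma a b : a <= b -> C1_curve LA gamma ->
  (`|(gamma b).1 - (gamma a).1|%:E <= curve_length g gamma a b)%E.
Proof.
move=> ab cg; have [df cf] := C1_curve_fst sA cg.
apply: le_trans (variation_le_integral_derive ab df cf) _.
rewrite -[leRHS]mul1e; apply: le_integral_scale => // s _.
- by rewrite lee_fin speed_ge0.
- by rewrite mul1e lee_fin speed_time_le.
Qed.

Lemma curve_length_sub gamma a b s : s \in `[a, b] ->
  (curve_length g gamma a s <= curve_length g gamma a b)%E.
Proof.
rewrite in_itv /= => /andP[_ sb].
rewrite -[leRHS]mul1e; apply: le_integral_scale => //.
- by apply: subset_itvl; rewrite bnd_simp.
- by move=> x _; rewrite lee_fin speed_ge0.
- by move=> x _; rewrite lee_fin speed_ge0.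
- by move=> x _; rewrite mul1e.
Qed.

(** The hypothesis keeps the whole path in the region [|t| <= T], where speeds in
    [N] are at most [exp T] times those in the product; it is inherited by the rest
    of the path because a piece changes [t] by at most its length. *)
Lemma project_path p q L (T : R) : path_length g p q L ->
  (`|p.1|%:E + L <= T%:E)%E ->
  (`|q.1 - p.1|%:E <= L)%E /\
  exists2 L', path_length h p.2 q.2 L' & (L' <= (expR T)%:E * L)%E.
Proof.
elim=> {p q L} [p|gamma a b q L ab cg pL IH] LT.
  rewrite subrr normr0; split=> //; exists 0%E; first exact: path_nil.
  by rewrite mule0.
have len0 := curve_length_ge0 g gamma a b.
have L0 := path_length_ge0 pL.
have bT : (`|(gamma b).1|%:E + L <= T%:E)%E.
  apply: le_trans LT; rewrite addeA leeD2r//.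
  apply: (@le_trans _ _ (`|(gamma a).1|%:E + `|(gamma b).1 - (gamma a).1|%:E)%E).
    by rewrite -EFinD lee_fin -{1}[(gamma b).1](subrK (gamma a).1) addrC ler_normD.
  by rewrite leeD2l// time_variation_le.
have [bq [L' pL' L'L]] := IH bT; split.
  apply: (@le_trans _ _
    (`|(gamma b).1 - (gamma a).1|%:E + `|q.1 - (gamma b).1|%:E)%E).
    rewrite -EFinD lee_fin.
    by rewrite (_ : q.1 - _ = ((gamma b).1 - (gamma a).1) + (q.1 - (gamma b).1));
      [exact: ler_normD|ring].
  by apply: leeD => //; exact: time_variation_le.
exists (curve_length h (snd \o gamma) a b + L')%E.
  by apply: (path_cons ab (C1_curve_snd sA cg)).
rewrite ge0_muleDr//; apply: leeD => //.
apply: le_integral_scale; [exact: expR_gt0|by []| | |].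
- by move=> s _; rewrite lee_fin speed_ge0.
- by move=> s _; rewrite lee_fin speed_ge0.
move=> s sab; rewrite -EFinM lee_fin; apply: le_trans (speed_space_le s cg) _.
rewrite ler_wpM2r ?speed_ge0// ler_expR -lee_fin.
apply: le_trans LT.
apply: (@le_trans _ _ (`|(gamma a).1|%:E + `|(gamma s).1 - (gamma a).1|%:E)%E).
  by rewrite -EFinD lee_fin -{1}[(gamma s).1](subrK (gamma a).1) addrC ler_normD.
rewrite leeD2l//; apply: le_trans (leeDl _ L0).
apply: le_trans (curve_length_sub gamma sab).
by apply: time_variation_le => //; move: sab; rewrite /= in_itv /= => /andP[].
Qed.

Lemma lift_path p q L (t : R) : path_length h p q L ->
  exists2 L', path_length g (t, p) (t, q) L' & (L' <= (expR `|t|)%:E * L)%E.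
Proof.
elim=> {p q L} [p|beta a b q L ab cb pL [L' pL' L'L]].
  by exists 0%E; [exact: path_nil|rewrite mule0].
exists (curve_length g (fun s => (t, beta s)) a b + L')%E.
  apply: (path_cons (gamma := fun s => (t, beta s)) ab _ pL').
  apply: (C1_curve_pair sA (alpha := cst t)) => //.
  rewrite (_ : derive1 _ = cst 0); first exact: cst_continuous.
  by apply/funext => x; rewrite derive1_cst.
have len0 := curve_length_ge0 h beta a b.
have L0 := path_length_ge0 pL.
rewrite ge0_muleDr//; apply: leeD => //.
apply: le_integral_scale; [exact: expR_gt0|by []| | |].
- by move=> s _; rewrite lee_fin speed_ge0.
- by move=> s _; rewrite lee_fin speed_ge0.
by move=> s _; rewrite -EFinM lee_fin; exact: speed_slice_le.
Qed.

(** The segment is affine in time, so its speed is constant. *)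
Lemma time_segment (q : N) (t t' : R) :
  exists2 gamma, C1_curve LA gamma & [/\ gamma 0 = (t, q), gamma 1 = (t', q) &
    (curve_length g gamma 0 1 <= `|t' - t|%:E)%E].
Proof.
pose al (s : R) := t + s * (t' - t).
have dal (s : R) : is_derive s (1 : R) al (t' - t).
  by apply: is_derive_eq; rewrite scaler0 !add0r mul1r [_%:A]mulr1.
have d1 : derive1 al = cst (t' - t).
  by apply/funext => s; rewrite derive1E derive_val.
have cg : C1_curve LA (fun s => (al s, q)).
  apply: C1_curve_pair => //; last exact: C1_curve_cst.
  by rewrite d1; exact: cst_continuous.
exists (fun s => (al s, q)) => //; split.
- by rewrite /al mul0r addr0.
- by rewrite /al mul1r addrC subrK.
have -> : curve_length g (fun s => (al s, q)) 0 1 =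
   (\int[lebesgue_measure]_(s in `[0%R, 1%R]) (cst `|t' - t|%:E s))%E.
  apply: eq_integral => s _; rewrite speed_prodE//.
  rewrite (_ : fst \o _ = al)// d1.
  rewrite (_ : _ \o _ = cst (coord (A (chart_at A q)) q))//.
  by rewrite derive1_cst /bil !mul0mx mxE addr0 sqrtr_sqr.
rewrite integral_cst//= lebesgue_measure_itv /= lte_fin ltr01.
by rewrite -EFinB subr0 mule1.
Qed.

(** First run along the time axis over [q], then inside the slice at time [t']. *)
Lemma dist_prod_le (q q' : N) (t t' : R) L : path_length h q q' L ->
  (riem_dist g (t, q) (t', q') <= `|t' - t|%:E + (expR `|t'|)%:E * L)%E.
Proof.
move=> pL; have [L' pL' L'L] := lift_path t' pL.
have [gamma cg [g0 g1 len]] := time_segment q t t'.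
rewrite -g1 in pL'; rewrite -g0.
apply: le_trans (riem_dist_le_path (path_cons ler01 cg pL')) _.
exact: leeD.
Qed.

Lemma riem_cauchy_time (u : nat -> R * N) : riem_cauchy g u ->
  forall e : R, 0 < e -> exists K : nat, forall k l : nat,
    (K <= k)%N -> (K <= l)%N -> `|(u l).1 - (u k).1| < e.
Proof.
move=> cu e e0; have [K uK] := cu e e0; exists K => k l Kk Kl.
have [L pL Le] := riem_dist_lt_path (uK k l Kk Kl).
have Lfin : L \is a fin_num.
  by rewrite ge0_fin_numE ?(path_length_ge0 pL)// (lt_trans Le) ?ltry.
have [|kl _] := project_path (T := `|(u k).1| + fine L) pL.
  by rewrite EFinD fineK.
by rewrite -lte_fin; exact: le_lt_trans kl Le.
Qed.

(** From some index on, times lie within 1 of [(u K0).1] and connecting paths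
    have length at most 1, whence the bound [T]. *)
Lemma riem_cauchy_space (u : nat -> R * N) : riem_cauchy g u ->
  riem_cauchy h (snd \o u).
Proof.
move=> cu e e0; have [K0 uK0] := riem_cauchy_time cu ltr01.
(* Projecting to N stretches lengths by at most [expR T]. *)
pose T := `|(u K0).1| + 2; pose e' := Num.min 1 (e / expR T).
have e'0 : 0 < e' by rewrite lt_min ltr01 divr_gt0// expR_gt0.
have [K uK] := cu e' e'0; exists (maxn K0 K) => k l; rewrite !geq_max.
move=> /andP[K0k Kk] /andP[K0l Kl].
have [L pL Le] := riem_dist_lt_path (uK k l Kk Kl).
have [|_ [L' pL' L'L]] := project_path (T := T) pL.
  apply: (@le_trans _ _ (`|(u k).1|%:E + 1%:E)%E).
    rewrite leeD2l//; apply: le_trans (ltW Le) _.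
    by rewrite lee_fin ge_min lexx.
  rewrite -EFinD lee_fin /T.
  have := uK0 K0 k (leqnn _) K0k.
  have := ler_normD ((u k).1 - (u K0).1) (u K0).1; rewrite subrK.
  lra.
apply: le_lt_trans (riem_dist_le_path pL') _; apply: le_lt_trans L'L _.
apply: (@lt_le_trans _ _ ((expR T)%:E * e'%:E)%E).
  by rewrite lte_pmul2l ?lte_fin ?expR_gt0.
by rewrite -EFinM lee_fin mulrC -ler_pdivlMr ?expR_gt0// ge_min lexx orbT.
Qed.

Lemma cauchy_real_cvg (v : nat -> R) :
  (forall e : R, 0 < e -> exists K : nat, forall k l : nat,
    (K <= k)%N -> (K <= l)%N -> `|v l - v k| < e) ->
  exists t, forall e : R, 0 < e -> exists K : nat, forall k : nat,
    (K <= k)%N -> `|t - v k| < e.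
Proof.
move=> cv; have /cauchy_cvgP/cvg_ex[/= t vt] : cauchy (v @ \oo).
  apply/cauchy_exP => e e0; have [K vK] := cv e e0; exists (v K).
  by exists K => // k /= Kk; rewrite /ball /= distrC; exact: vK.
exists t => e e0; have /cvgrPdist_lt/(_ e e0)[K _ vK] := vt.
by exists K => k; exact: vK.
Qed.

Lemma riem_complete_prod : riem_complete h -> riem_complete g.
Proof.
move=> ch u cu.
have [t ut] := cauchy_real_cvg (riem_cauchy_time cu).
have [q uq] := ch _ (riem_cauchy_space cu).
exists (t, q) => e e0.
have e20 : 0 < e / 2 by rewrite divr_gt0.
have et0 : 0 < e / 2 / expR `|t| by rewrite divr_gt0// expR_gt0.
(* [dist_prod_le] multiplies the distance in N by [expR `|t|]. *)
have [K1 tK] := ut _ e20; have [K2 qK] := uq _ et0.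
exists (maxn K1 K2) => k; rewrite geq_max => /andP[K1k K2k].
have [L pL Le] := riem_dist_lt_path (qK k K2k).
rewrite [u k]surjective_pairing.
apply: le_lt_trans (dist_prod_le (u k).1 t pL) _.
rewrite (splitr e) EFinD; apply: lee_ltD => //.
  by rewrite lee_fin ltW// tK.
apply: (@lt_le_trans _ _ ((expR `|t|)%:E * (e / 2 / expR `|t|)%:E)%E).
  by rewrite lte_pmul2l ?lte_fin ?expR_gt0.
by rewrite -EFinM lee_fin mulrC divfK// gt_eqF// expR_gt0.
Qed.

End Completeness.

(** * The para-Sasaki-like product *)

Theorem theorem2p4 (R : realType) (N : topologicalType) (n : nat)
    (A : atlas R N n.*2) (P h : field A n.*2 n.*2) :
  paraholomorphic P h ->
  let g := prod_metric h (assoc_metric P h) in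
  para_sasaki_like (prod_phi P) (prod_xi A) (prod_eta A) g /\
  (riem_complete h -> riem_complete g).
Proof.
move=> ph g; split; last exact: riem_complete_prod.
have [D hD hP] := ph_parallel ph.
exact: (para_sasaki_like_prod ph hD hP).
Qed.
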